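(* Let $(a_\alpha,b_\alpha:\alpha<\omega_1)$ be a Hausdorff gap of subsets of $\omega$, identified with their characteristic functions in $2^\omega$, such that $L:=\{a_\alpha:\alpha<\omega_1\}\cup\{b_\alpha:\alpha<\omega_1\}$ is dense in $2^\omega$. Order $L$ by the lexicographic order of $2^\omega$. Then the interval algebra $\mathcal B(L)$ is hereditary, i.e., every subalgebra of $\mathcal B(L)$ is an interval algebra.
   Context: For a linear order $L$, $\mathcal B(L)$ is the Boolean subalgebra of the power set of $L$ generated by the sets $\{y\in L: x\le y\}$, $x\in L$. An interval algebra is a Boolean algebra isomorphic to the algebra of finite unions of half-open intervals of some linear order. A Hausdorff gap is a family $(a_\alpha,b_\alpha:\alpha<\omega_1)$ of infinite subsets of $\omega$ such that $a_\alpha\subsetneq^* a_\beta\subsetneq^* b_\beta\subsetneq^* b_\alpha$ for $\alpha<\beta$ (modulo finite) and there is no $c\subseteq\omega$ with $a_\alpha\subseteq^* c\subseteq^* b_\alpha$ for all $\alpha$ (the standard notion; any formulation of Hausdorff's $(\omega_1,\omega_1)$-gap may be used). *)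

(* Defs.v *)
From HB Require Import structures.
From mathcomp Require Import all_boot all_order.
From mathcomp Require Import interval all_classical.
From mathcomp Require Import topology cantor.
From mathcomp Require wochoice.

Set Implicit Arguments.
Unset Strict Implicit.
Unset Printing Implicit Defensive.

Import Order.TTheory.

Local Open Scope classical_set_scope.

(* Boolean algebras are ctbDistrLatticeType's, in particular [set T]; a
   subalgebra is given by its carrier, a subset of the ambient algebra. *)

Definition ba_subalgebra d (B : ctbDistrLatticeType d) (S : set B) : Prop :=
  [/\ S \bot%O, S \top%O,
      forall x y, S x -> S y -> S (x `|` y)%O,
      forall x y, S x -> S y -> S (x `&` y)%O
    & forall x, S x -> S (~` x)%O].

Definition ba_generated d (B : ctbDistrLatticeType d) (G : set B) : set B :=
  smallest (@ba_subalgebra d B) G.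

Definition ba_isomorphic d (B : ctbDistrLatticeType d) d'
    (B' : ctbDistrLatticeType d') (S : set B) (S' : set B') : Prop :=
  exists f : B -> B',
    [/\ set_bij S S' f,
        f \bot%O = \bot%O /\ f \top%O = \top%O,
        forall x y, S x -> S y -> f (x `|` y)%O = (f x `|` f y)%O,
        forall x y, S x -> S y -> f (x `&` y)%O = (f x `&` f y)%O
      & forall x, S x -> f (~` x)%O = (~` f x)%O].

(* End points range over K together with -oo and +oo, so that the finite unions
   below are closed under complement whether or not K has a least element. *)
Definition half_open_interval d (K : orderType d) (A : set K) : Prop :=
  [\/ exists x y : K, A = `[x, y[%classic, exists x : K, A = `[x, +oo[%classic,
      exists y : K, A = `]-oo, y[%classic | A = setT].

Definition half_open_unions d (K : orderType d) : set (set K) :=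
  [set A | exists F : set (set K),
     [/\ finite_set F, F `<=` @half_open_interval d K
       & A = \bigcup_(X in F) X]].
Arguments half_open_unions {d} K.

Definition is_interval_algebra d (B : ctbDistrLatticeType d) (S : set B)
    : Prop :=
  exists d' (K : orderType d'), ba_isomorphic S (half_open_unions K).

Definition hereditary d (B : ctbDistrLatticeType d) (S : set B) : Prop :=
  forall S' : set B, ba_subalgebra S' -> S' `<=` S -> is_interval_algebra S'.

Definition calB d (L : orderType d) : set (set L) :=
  ba_generated [set [set y | (x <= y)%O] | x in [set: L]].
Arguments calB {d} L.

HB.instance Definition _ (T : choiceType) (A : set T) :=
  SubChoice.on (set_type A).
HB.instance Definition _ d (T : orderType d) (A : set T) :=
  [SubChoice_isSubOrder of set_type A by <: with d].

(* [I] has order type omega_1. *)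
Definition omega1_order d (I : orderType d) : Prop :=
  [/\ wochoice.well_order (<=%O : rel I), ~ countable [set: I]
    & forall i : I, countable [set j | (j < i)%O]].

Definition almost_subset (A B : set nat) : Prop := finite_set (A `\` B).

Definition almost_proper (A B : set nat) : Prop :=
  almost_subset A B /\ ~ almost_subset B A.

Definition hausdorff_gap d (I : orderType d) (a b : I -> set nat) : Prop :=
  [/\ omega1_order I,
      forall i, infinite_set (a i) /\ infinite_set (b i),
      forall i j, (i < j)%O -> [/\ almost_proper (a i) (a j),
        almost_proper (a j) (b j) & almost_proper (b j) (b i)]
    & ~ exists c : set nat,
        forall i, almost_subset (a i) c /\ almost_subset c (b i)].

Definition charfun (A : set nat) : nat -> bool := fun n => n \in A.

Definition gap_points (I : Type) (a b : I -> set nat) : set (nat -> bool) :=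
  range (charfun \o a) `|` range (charfun \o b).

(* 2^omega ordered lexicographically, with false < true. *)
Definition lex2 := big_lexi_order (fun _ : nat => bool).
HB.instance Definition _ := Order.Total.on lex2.

Definition lex_gap_points (I : Type) (a b : I -> set nat) : set lex2 :=
  gap_points a b.

(* Main.v *)
(* An element of B(L) is a finite union of half-open intervals, so it has
   finitely many jumps (points where it is discontinuous from the left), and
   the set of jumps of a symmetric difference is the symmetric difference of
   the sets of jumps. Let S be a subalgebra of B(L) and let Q be a countable
   subset of L closed under suitable countable choices. Call a jump essential
   if it is not in Q. The elements of S without essential jumps form a
   countable subalgebra, the ground, and S is generated by the ground together
   with the elements whose set of essential jumps is minimal and nonempty.
   Minimal elements fall into countably many families, according to the
   cylinders containing their jumps and to the directions of these jumps. By
   minimality an element of the ground contains all essential jumps of a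
   minimal element or none of them; hence each family is a chain.

   The gap enters only as follows: for every countable D in 2^omega, the set
   L \ D is covered by an increasing sequence of closed sets missing D, namely
   {c | a_i <=* c <=* b_i} for one large i, up to countably many points. Let D
   consist of Q and of the countably many points that are limits of the end
   points in some family from one side only. The covering cuts the families
   into countably many pieces all of whose limits are limits from both sides in
   every coordinate, so that these limits are separated by the ground from
   everything else. By compactness one can then refine finite partitions into
   elements of the ground, linearly ordered, in such a way that eventually every
   minimal element is an initial segment up to an element of the ground. The
   resulting initial segments form a chain that generates S. *)
Require Import Defs.
From HB Require Import structures.
From mathcomp Require Import all_boot all_order.
From mathcomp Require Import interval all_classical.
From mathcomp Require Import topology cantor.

Set Implicit Arguments.
Unset Strict Implicit.
Unset Printing Implicit Defensive.

Import Order.TTheory.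

Local Open Scope classical_set_scope.

(** * Algebras generated by a chain *)

Lemma ba_subalgebra_setP T (S : set (set T)) :
  ba_subalgebra S <->
  [/\ S set0, S setT, forall u v, S u -> S v -> S (u `|` v),
      forall u v, S u -> S v -> S (u `&` v) & forall u, S u -> S (~` u)].
Proof. by []. Qed.

Section Subalgebra.
Context (T : Type) (S : set (set T)) (algS : ba_subalgebra S).

Lemma alg_set0 : S set0. Proof. by case: algS. Qed.
Lemma alg_setT : S setT. Proof. by case: algS. Qed.
Lemma alg_setU u v : S u -> S v -> S (u `|` v).
Proof. by case: algS => _ _ + _ _; exact. Qed.
Lemma alg_setI u v : S u -> S v -> S (u `&` v).
Proof. by case: algS => _ _ _ + _; exact. Qed.
Lemma alg_setC u : S u -> S (~` u). Proof. by case: algS => _ _ _ _; exact. Qed.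
Lemma alg_setD u v : S u -> S v -> S (u `\` v).
Proof. by move=> Su Sv; rewrite setDE; apply: alg_setI => //; apply: alg_setC. Qed.
Lemma alg_bigU (I : eqType) (s : seq I) (F : I -> set T) (P : I -> Prop) :
  (forall i, i \in s -> P i -> S (F i)) ->
  S [set x | exists i, [/\ i \in s, P i & F i x]].
Proof.
elim: s => [|i s IH] H.
  by rewrite (_ : mkset _ = set0); [exact: alg_set0|apply/seteqP;
    split=> x //= -[? []]].
have {}IH : S [set x | exists i, [/\ i \in s, P i & F i x]].
  by apply: IH => j js; apply: H; rewrite inE js orbT.
have [Pi|nPi] := pselect (P i).
  rewrite (_ : mkset _ = F i `|` [set x | exists i, [/\ i \in s, P i & F i x]]).
    by apply: alg_setU => //; apply: H => //; rewrite inE eqxx.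
  apply/seteqP; split=> x /=.
    by case=> j; rewrite inE => -[/orP[/eqP->|js] Pj Fj]; [left|right; exists j].
  case=> [Fi|[j [js Pj Fj]]]; first by exists i; rewrite inE eqxx.
  by exists j; rewrite inE js orbT.
rewrite (_ : mkset _ = [set x | exists i, [/\ i \in s, P i & F i x]]) //.
apply/seteqP; split=> x /= -[j []]; last first.
  by move=> js Pj Fj; exists j; rewrite inE js orbT.
by rewrite inE => /orP[/eqP-> /nPi//|js Pj Fj]; exists j.
Qed.
End Subalgebra.

Lemma generated_alg T (G : set (set T)) : ba_subalgebra (ba_generated G).
Proof.
apply/ba_subalgebra_setP; split.
- by move=> M [MA _]; exact: alg_set0 MA.
- by move=> M [MA _]; exact: alg_setT MA.
- by move=> u v Hu Hv M HM; apply: (alg_setU HM.1); [exact: Hu|exact: Hv].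
- by move=> u v Hu Hv M HM; apply: (alg_setI HM.1); [exact: Hu|exact: Hv].
- by move=> u Hu M HM; apply: (alg_setC HM.1); exact: Hu.
Qed.

Lemma generated_sub T (G S : set (set T)) :
  ba_subalgebra S -> G `<=` S -> ba_generated G `<=` S.
Proof. exact: smallest_sub. Qed.

Lemma generated_incl T (G : set (set T)) : G `<=` ba_generated G.
Proof. exact: sub_gen_smallest. Qed.

Definition is_chain T (C : set (set T)) :=
  forall u v, C u -> C v -> u `<=` v \/ v `<=` u.

Section ChainGenerated.
Context (T : Type) (S C : set (set T)).
Hypothesis algS : ba_subalgebra S.
Hypothesis chC : is_chain C.
Hypothesis CS : C `<=` S.
Hypothesis genC : S `<=` ba_generated C.
Context (t0 : T).

(** [C0] holds the left ends and [C1] the right ends of intervals, an interval being a difference of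
    two chain members. Nothing lies after the whole set, so it is left out of [KK], which will carry
    the linear order. *)
Let C0 : set (set T) := [set k | C k \/ k = set0].
Let C1 : set (set T) := [set k | C k \/ k = setT].
Let KK : set (set T) := [set k | C0 k /\ k <> setT].

Let chC01 u v : C u \/ u = set0 \/ u = setT -> C v \/ v = set0 \/ v = setT ->
  u `<=` v \/ v `<=` u.
Proof.
move=> [Cu|[->|->]] [Cv|[->|->]]; by [exact: chC|left|right].
Qed.

(** The right-hand neighbourhoods of the cut [k]. For [k] in [KK] they form a filter whose trace on
    [S] is an ultrafilter, a point of the Stone space of [S]. *)
Let after (k u : set T) := exists c, [/\ C1 c, k `<` c & c `\` k `<=` u].

Let afterW k u v : u `<=` v -> after k u -> after k v.
Proof. by move=> uv [c [? ? ck]]; exists c; split=> // x /ck /uv. Qed.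

Let afterI k u v : C0 k -> after k u -> after k v -> after k (u `&` v).
Proof.
move=> Kk [c [Cc kc cu]] [c' [Cc' kc' cv]].
have [] := @chC01 c c'; try by move: Cc Cc'; rewrite /C1 /=; tauto.
  by move=> cc'; exists c; split=> // x [cx kx]; split;
    [exact: cu|apply: cv; split=> //; exact: cc'].
by move=> cc'; exists c'; split=> // x [cx kx]; split;
  [apply: cu; split=> //; exact: cc'|exact: cv].
Qed.

Let after0 k : ~ after k set0.
Proof.
move=> [c [_ [kc nck] c0]]; apply: nck => x cx.
by apply: contrapT => nkx; exact: (c0 x).
Qed.

(** The sets decided at [k] form an algebra. If a chain member lies inside [k], its complement
    contains everything after [k]; otherwise it properly contains [k] and is its own witness. *)
Let afterP k u : KK k -> S u -> after k u \/ after k (~` u).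
Proof.
move=> [Kk knT] /genC; move: u; apply: generated_sub.
  have kT : k `<` setT.
    by split=> // Tk; apply: knT; apply/seteqP; split.
  have aT : after k setT by exists setT; split=> //; right.
  apply/ba_subalgebra_setP; split; rewrite /=.
  - by right; rewrite setC0.
  - by left.
  - move=> u v [au _|au [av|av]]; [left|left|right].
    + by apply: afterW au => x; left.
    + by apply: afterW av => x; right.
    + by rewrite setCU; apply: afterI.
  - move=> u v [au [av|av]|au _]; [left|right|right].
    + exact: afterI.
    + by apply: afterW av => x vx [].
    + by apply: afterW au => x ux [].
  - by move=> u [] au; [right; rewrite setCK|left].
move=> u Cu /=.
have [] := @chC01 u k; [by left|by case: Kk; tauto|move=> uk|move=> ku].
  right; exists setT; split; [by right| |by move=> x [_ kx] /uk].
  by split=> // Tk; apply: knT; apply/seteqP; split.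
have [uk|nuk] := pselect (u `<=` k).
  right; exists setT; split; [by right| |by move=> x [_ kx] /uk].
  by split=> // Tk; apply: knT; apply/seteqP; split.
by left; exists u; split; [left| |move=> x []].
Qed.

Let finite_decide u : S u -> exists2 s : seq (set T), {in s, forall c, C c} &
  forall x y, (forall c, c \in s -> c x = c y) -> u x = u y.
Proof.
move/genC; move: u; apply: generated_sub.
  apply/ba_subalgebra_setP; split; rewrite /=.
  - by exists [::].
  - by exists [::].
  - move=> u v [s Cs Hu] [s' Cs' Hv]; exists (s ++ s') => [c|x y H].
      by rewrite mem_cat => /orP[/Cs|/Cs'].
    rewrite /setU /mkset (Hu x y) ?(Hv x y) // => c cs; apply: H;
    by rewrite mem_cat cs ?orbT.
  - move=> u v [s Cs Hu] [s' Cs' Hv]; exists (s ++ s') => [c|x y H].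
      by rewrite mem_cat => /orP[/Cs|/Cs'].
    rewrite /setI /mkset (Hu x y) ?(Hv x y) // => c cs; apply: H;
    by rewrite mem_cat cs ?orbT.
  - by move=> u [s Cs Hu]; exists s => // x y H; rewrite /setC /mkset (Hu x y).
move=> u Cu; exists [:: u] => [c|x y H]; first by rewrite inE => /eqP->.
by apply: H; rewrite inE eqxx.
Qed.

Let chain_max (s : seq (set T)) : {in s, forall c, C c} ->
  forall x, exists k, [/\ k = set0 \/ k \in s, ~ k x &
    forall c, c \in s -> ~ c x -> c `<=` k].
Proof.
move=> + x; elim: s => [|c s IH] Cs; first by exists set0; split=> //; left.
have [|k [ks kx km]] := IH; first by move=> c' c's; apply: Cs; rewrite inE c's orbT.
have Ck : C k \/ k = set0 \/ k = setT.
  by case: ks => [->|ks]; [right; left|left; apply: Cs; rewrite inE ks orbT].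
have Cc : C c by apply: Cs; rewrite inE eqxx.
have kcs : k = set0 \/ k \in c :: s by case: ks => [|ks]; [left|right;
  rewrite inE ks orbT].
have km' : c x \/ c `<=` k -> forall c', c' \in c :: s -> ~ c' x -> c' `<=` k.
  by move=> H c'; rewrite inE => /orP[/eqP->|/km//]; case: H.
have [cx|ncx] := pselect (c x); first by exists k; split=> //; apply: km'; left.
have [ck|kc] := @chC01 c k (or_introl Cc) Ck.
  by exists k; split=> //; apply: km'; right.
exists c; split=> //; first by right; rewrite inE eqxx.
move=> e; rewrite inE => /orP[/eqP-> _|es ex]; first exact: subset_refl.
exact: subset_trans (km _ es ex) kc.
Qed.

Let chain_min (s : seq (set T)) : {in s, forall c, C c} ->
  forall x, exists k, [/\ k = setT \/ k \in s, k x &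
    forall c, c \in s -> c x -> k `<=` c].
Proof.
move=> + x; elim: s => [|c s IH] Cs; first by exists setT; split=> //; left.
have [|k [ks kx km]] := IH; first by move=> c' c's; apply: Cs; rewrite inE c's orbT.
have Ck : C k \/ k = set0 \/ k = setT.
  by case: ks => [->|ks]; [right; right|left; apply: Cs; rewrite inE ks orbT].
have Cc : C c by apply: Cs; rewrite inE eqxx.
have kcs : k = setT \/ k \in c :: s by case: ks => [|ks]; [left|right;
  rewrite inE ks orbT].
have km' : ~ c x \/ k `<=` c -> forall c', c' \in c :: s -> c' x -> k `<=` c'.
  by move=> H c'; rewrite inE => /orP[/eqP->|/km//]; case: H.
have [cx|ncx] := pselect (c x); last by exists k; split=> //; apply: km'; left.
have [ck|kc] := @chC01 c k (or_introl Cc) Ck.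
  exists c; split=> //; first by right; rewrite inE eqxx.
  move=> e; rewrite inE => /orP[/eqP-> _|es ex]; first exact: subset_refl.
  exact: subset_trans ck (km _ es ex).
by exists k; split=> //; apply: km'; right.
Qed.

(** The ends are the largest listed set avoiding [x] and the smallest one containing it; all points
    between them lie in the same listed sets as [x]. *)
Let piece (s : seq (set T)) (u : set T) x : {in s, forall c, C c} ->
  (forall x y, (forall c, c \in s -> c x = c y) -> u x = u y) -> u x ->
  exists k c, [/\ k = set0 \/ k \in s, c = setT \/ c \in s, ~ k x, c x
    & c `\` k `<=` u].
Proof.
move=> Cs Hu ux; have [k [ks kx km]] := chain_max Cs x.
have [c [cs cx cm]] := chain_min Cs x.
exists k, c; split=> // y [cy ky]; rewrite -(Hu x y) // => e es; apply/propext.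
have [ex|nex] := pselect (e x); split=> //.
  by move=> _; exact: cm es ex y cy.
by move=> ey; case: ky; exact: (km _ es nex).
Qed.

Let le (k k' : set_type KK) : bool := `[< val k `<=` val k' >].

(** The map [f] evaluates [u] at the ultrafilters of all cuts in [KK]. It is injective because a
    nonempty [u] contains an interval, and it sends differences of chain members to half-open
    intervals of the order [K]. *)
Lemma chain_interval_algebra : is_interval_algebra S.
Proof.
have le_refl : reflexive le by move=> k; apply/asboolP.
have le_anti : antisymmetric le.
  by move=> k k' /andP[/asboolP H /asboolP H']; apply/val_inj/seteqP.
have le_trans : transitive le.
  move=> k k' k'' /asboolP H /asboolP H'; apply/asboolP.
  exact: subset_trans H'.
pose pK := Order.Le_isPOrder.Build set_display (set_type KK) le_refl le_anti le_trans.
pose P : porderType set_display := HB.pack (set_type KK) pK.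
have le_tot : total (<=%O : rel P).
  move=> k k'; apply/orP.
  have [] := @chC01 (val k) (val k').
  - by have := set_valP k; rewrite /KK /C0 /=; tauto.
  - by have := set_valP k'; rewrite /KK /C0 /=; tauto.
  - by move=> H; left; apply/asboolP.
  - by move=> H; right; apply/asboolP.
pose K : orderType set_display :=
  HB.pack (set_type KK) pK (Order.POrder_isTotal.Build set_display P le_tot).
have leK (k k' : K) : (k <= k')%O = `[< val k `<=` val k' >] by [].
have ltK (k k' : K) : (k < k')%O <-> val k `<` val k'.
  rewrite lt_neqAle leK; split.
    move=> /andP[ne /asboolP H]; split=> // H'.
    by move/eqP: ne; apply; apply/val_inj/seteqP.
  move=> [H nH]; apply/andP; split; last exact/asboolP.
  by apply/eqP => e; apply: nH; rewrite e.
pose f (u : set T) : set K := [set k | after (val k) u].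
have KKk (k : K) : KK (val k) by exact: set_valP.
have fU u v : S u -> S v -> f (u `|` v) = f u `|` f v.
  move=> Su Sv; apply/seteqP; split=> k /=.
    move=> auv; have [|au] := afterP (KKk k) Su; first by left.
    right; have := afterI (KKk k).1 auv au.
    by apply: afterW => x [[]].
  by case; apply: afterW => x; [left|right].
have fI u v : S u -> S v -> f (u `&` v) = f u `&` f v.
  move=> Su Sv; apply/seteqP; split=> k /=.
    by move=> a; split; apply: afterW a => x [].
  by case=> a b; apply: afterI => //; exact: (KKk k).1.
have fC u : S u -> f (~` u) = ~` f u.
  move=> Su; apply/seteqP; split=> k /=.
    move=> a b; apply: (@after0 (val k)).
    by have := afterI (KKk k).1 a b; apply: afterW => x [].
  by move=> na; have [] := afterP (KKk k) Su.
have f0 : f set0 = set0 by apply/seteqP; split=> k //= /after0.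
have fT : f setT = setT by rewrite -setC0 fC ?f0 ?setC0 //; exact: alg_set0 algS.
have f_eq0 u : S u -> f u = set0 -> u = set0.
  move=> Su fu0; apply/seteqP; split=> x // ux.
  have [s Cs Hs] := finite_decide Su.
  have [k [c [ks cs kx cx cku]]] := piece Cs Hs ux.
  have Kk : KK k.
    split; last by move=> e; apply: kx; rewrite e.
    by case: ks => [->|/Cs]; [right|left].
  have : f u (SigSub (mem_set Kk)).
    exists c; split=> //; first by case: cs => [->|/Cs]; [right|left].
    rewrite /=; have [] := @chC01 k c.
    + by case: ks => [->|/Cs]; tauto.
    + by case: cs => [->|/Cs]; tauto.
    + by move=> kc; split=> // ck; apply: kx; exact: ck.
    + by move=> /(_ x cx).
  by rewrite fu0.
have fD c k (Cc : C1 c) (Kk : KK k) : f (c `\` k) =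
    [set k' : K | k `<=` val k' /\ val k' `<` c].
  apply/seteqP; split=> k' /=.
    move=> [e [Ce [k'e nek'] eck]].
    have [x /= ex k'x] : exists2 x, e x & ~ val k' x.
      apply: contrapT => H; apply: nek' => x ex; apply: contrapT => nx.
      by apply: H; exists x.
    have [cx kx] := eck _ (conj ex k'x).
    have C1k' : C (val k') \/ val k' = set0 \/ val k' = setT.
      by case: (KKk k').1; tauto.
    split.
      have Hk : C k \/ k = set0 \/ k = setT by case: Kk.1; tauto.
      have He : C e \/ e = set0 \/ e = setT by case: Ce; tauto.
      move=> z kz; apply: contrapT => nk'z; have [ke|ek] := chC01 Hk He.
        by have [] := eck z (conj (ke z kz) nk'z).
      by apply: kx; exact: ek.
    have [||k'c|ck'] := @chC01 (val k') c.
    + by case: (KKk k').1; tauto.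
    + by case: Cc; tauto.
    + by split=> // ck'; apply: k'x; exact: ck'.
    + by case: k'x; exact: ck'.
  move=> [kk' k'c]; exists c; split=> // x [cx k'x]; split=> // kx.
  by apply: k'x; exact: kk'.
have itv_co (x y : K) :
    `[x, y[%classic = [set k | val x `<=` val k /\ val k `<` val y].
  rewrite set_itvE; apply/seteqP; split=> k /=.
    by move=> /andP[xk /ltK ky]; split=> //; move: xk; rewrite leK => /asboolP.
  move=> [xk ky]; apply/andP; split; first by rewrite leK; apply/asboolP.
  exact/ltK.
have ltT (k : K) : val k `<` setT.
  by split=> // Tk; apply: (KKk k).2; apply/seteqP; split.
have itv_cy (x : K) :
    `[x, +oo[%classic = [set k | val x `<=` val k /\ val k `<` setT].
  rewrite set_itvE; apply/seteqP; split=> k /=; rewrite leK.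
    by move=> /asboolP xk; split=> //; exact: ltT.
  by move=> [xk _]; apply/asboolP.
have itv_Nyo (y : K) : `]-oo, y[%classic = [set k : K | val k `<` val y].
  by rewrite set_itvE; apply/seteqP; split=> k /= /ltK.
(* The point [t0] keeps the empty set apart from the whole set, so that [K] has a least element. *)
have KK0 : KK set0.
  split; first by right.
  by move=> e; have : (set0 : set T) t0 by rewrite e.
have SC0 k : C0 k -> S k by move=> [/CS//|->]; exact: alg_set0 algS.
have SC1 k : C1 k -> S k by move=> [/CS//|->]; exact: alg_setT algS.
have f_itv (s : seq (set T * set T)) (R : set T * set T -> Prop) :
    (forall p, p \in s -> R p -> S (p.2 `\` p.1)) ->
  f [set x | exists p, [/\ p \in s, R p & (p.2 `\` p.1) x]] `<=`
  [set k | exists p, [/\ p \in s, R p & f (p.2 `\` p.1) k]].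
  elim: s => [|p s IH] H k.
    rewrite (_ : mkset _ = set0); first by move/after0.
    by apply/seteqP; split=> x //= -[? []].
  have sS q : q \in s -> R q -> S (q.2 `\` q.1).
    by move=> qs; apply: H; rewrite inE qs orbT.
  have [Rp|nRp] := pselect (R p).
    rewrite (_ : mkset _ = (p.2 `\` p.1) `|`
        [set x | exists p, [/\ p \in s, R p & (p.2 `\` p.1) x]]).
      rewrite fU; last exact: (alg_bigU algS).
        2: by apply: H => //; rewrite inE eqxx.
      case=> [fk|/IH[//|q [qs Pq fq]]]; first by exists p; rewrite inE eqxx.
      by exists q; rewrite inE qs orbT.
    apply/seteqP; split=> x /=.
      by case=> j; rewrite inE => -[/orP[/eqP->|js] Pj Fj]; [left|right; exists j].
    case=> [Fi|[j [js Pj Fj]]]; first by exists p; rewrite inE eqxx.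
    by exists j; rewrite inE js orbT.
  rewrite (_ : mkset _ =
        [set x | exists p, [/\ p \in s, R p & (p.2 `\` p.1) x]]).
    by move=> /IH[//|q [qs Pq fq]]; exists q; rewrite inE qs orbT.
  apply/seteqP; split=> x /= -[j []].
    by rewrite inE => /orP[/eqP-> /nRp//|js Pj Fj]; exists j.
  by move=> js Pj Fj; exists j; rewrite inE js orbT.
exists set_display, K, f; split; [|by split|exact: fU|exact: fI|exact: fC].
split.
- move=> u /= Su; have [s Cs Hs] := finite_decide Su.
  pose g (p : set T * set T) := f (p.2 `\` p.1).
  (* By [piece], [u] is the union of those intervals inside it whose ends are listed or trivial. *)
  pose s0 := set0 :: s; pose s1 := setT :: s.
  pose D (p : set T * set T) := p.2 `\` p.1 `<=` u.
  pose W : seq (set T * set T) := [seq (x, y) | x <- s0, y <- s1].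
  have WP p : p \in W -> p.1 \in s0 /\ p.2 \in s1.
    by move=> /allpairsP[[x y] [xs ys ->]].
  have Ss0 k : k \in s0 -> C0 k.
    by rewrite inE => /orP[/eqP->|/Cs]; [right|left].
  have Ss1 k : k \in s1 -> C1 k.
    by rewrite inE => /orP[/eqP->|/Cs]; [right|left].
  have SW p : p \in W -> D p -> S (p.2 `\` p.1).
    move=> /WP[/Ss0 p1 /Ss1 p2] _; apply: (alg_setD algS); [exact: SC1|exact: SC0].
  exists (g @` [set p | p \in W /\ D p]); split.
  + apply: finite_image.
    by apply: (@sub_finite_set _ _ [set` W]) => [p []//|]; exact: finite_seq.
  + move=> _ [[k c] [/= /WP/= [ks cs] cku] <-]; rewrite /g /=.
    (* The chain may contain the whole set; an interval starting there is empty. *)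
    have [kT|knT] := pselect (k = setT).
      rewrite kT setDT f0; constructor 1.
      by exists (SigSub (mem_set KK0)), (SigSub (mem_set KK0)); rewrite set_itvE.
    have Kk : KK k by split=> //; exact: Ss0.
    rewrite fD //; last exact: Ss1.
    have [cT|cnT] := pselect (c = setT).
      by constructor 2; exists (SigSub (mem_set Kk)); rewrite itv_cy cT.
    have Kc : KK c by split=> //; case: (Ss1 c cs) => // Cc; left.
    constructor 1; exists (SigSub (mem_set Kk)), (SigSub (mem_set Kc)).
    by rewrite itv_co.
  + apply/seteqP; split=> k; last by move=> [_ [p [pW pu] <-]]; exact: afterW.
    have -> : u = [set x | exists p, [/\ p \in W, D p & (p.2 `\` p.1) x]].
      apply/seteqP; split=> x /=; last by case=> p [_]; exact.
      move=> ux; have [k' [c [ks cs kx cx cku]]] := piece Cs Hs ux.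
      have k's0 : k' \in s0 by rewrite inE; case: ks => [->|->]; rewrite ?eqxx ?orbT.
      have cs1 : c \in s1 by rewrite inE; case: cs => [->|->]; rewrite ?eqxx ?orbT.
      by exists (k', c); split=> //; apply/allpairsP; exists (k', c).
    by move=> /f_itv[//|p [pW Dp fk]]; exists (g p) => //; exists p.
- move=> u v /set_mem Su /set_mem Sv fuv.
  have H u' v' : S u' -> S v' -> f u' = f v' -> u' `<=` v'.
    move=> Su' Sv' e x ux; apply: contrapT => nvx.
    have : u' `&` ~` v' = set0.
      apply: f_eq0; first by apply: (alg_setI algS) => //; exact: (alg_setC algS).
      by rewrite fI ?fC ?e ?setICr //; exact: (alg_setC algS).
    by move=> /seteqP[/(_ x) /= H _]; apply: H.
  by apply/seteqP; split; apply: H.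
- move=> A [F [finF FI ->]].
  have pre X : half_open_interval X -> exists2 u, S u & f u = X.
    have sv (k : K) : C0 (val k) by exact: (KKk k).1.
    case.
    + move=> [x [y ->]]; exists (val y `\` val x).
        by apply: (alg_setD algS); exact: SC0.
      case: (sv y) => [Cy|y0]; first by rewrite fD ?itv_co //; left.
      rewrite y0 set0D f0 itv_co y0; apply/seteqP; split=> z //= -[_ [_ nz]].
      by apply: nz.
    + move=> [x ->]; exists (setT `\` val x).
        by apply: (alg_setD algS); [exact: alg_setT algS|exact: SC0].
      by rewrite fD ?itv_cy //; right.
    + move=> [y ->]; exists (val y); first exact: SC0.
      rewrite itv_Nyo; case: (sv y) => [Cy|y0].
        have := fD _ _ (or_introl Cy : C1 (val y)) KK0; rewrite setD0 => ->.
        by apply/seteqP; split=> z /=; [case|move=> zy; split].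
      by rewrite y0 f0; apply/seteqP; split=> z //= -[_ nz]; apply: nz.
    + by move=> ->; exists setT => //; exact: alg_setT algS.
  have [s sF] := (finite_seqP F).1 finF.
  have : forall X, X \in s -> half_open_interval X by move=> X Xs; apply: FI;
    rewrite sF.
  rewrite sF => {sF FI finF}; elim: s => [|X s IH] H.
    exists set0; first exact: alg_set0 algS.
    by rewrite f0; apply/seteqP; split=> k //= -[].
  have [|u Su fu] := IH; first by move=> Y Ys; apply: H; rewrite inE Ys orbT.
  have [|v Sv fv] := pre X; first by apply: H; rewrite inE eqxx.
  exists (v `|` u); first exact: (alg_setU algS).
  rewrite fU // fu fv; apply/seteqP; split=> k /=.
    by case=> [Xk|[Y Ys Yk]]; [exists X; rewrite /= ?inE ?eqxx|exists Y;
      rewrite //= inE Ys orbT].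
  case=> Y /=; rewrite inE => /orP[/eqP->|Ys] Yk; first by left.
  by right; exists Y.
Qed.

End ChainGenerated.

(** * Refining ordered partitions *)

Lemma countable_enum T (D : set T) d : countable D -> D d ->
  exists2 g : nat -> T, forall n, D (g n) & forall x, D x -> exists n, g n = x.
Proof.
move=> /countable_injP[h hinj] Dd.
have H n : exists x, D x /\ forall y, D y -> h y = n -> y = x.
  have [[y [Dy hy]]|ny] := pselect (exists y, D y /\ h y = n).
    exists y; split=> // z Dz hz; apply: hinj; rewrite ?inE // hy //.
  by exists d; split=> // y Dy hy; case: ny; exists y.
have /choice[g Hg] := H; exists g => [n|x Dx]; first by case: (Hg n).
by exists (h x); have [_ /(_ x Dx erefl)] := Hg (h x).
Qed.

Section OrderedPartition.
Context (T : Type).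
Notation piece := (option nat * set T)%type.
Implicit Types (w : set T) (s : seq piece) (p q : piece).

(* [s] lists pairwise disjoint labelled sets with union [w]. *)
Fixpoint parts w s : Prop :=
  if s is p :: s' then p.2 `<=` w /\ parts (w `\` p.2) s' else w = set0.

(** The rank turns the order of the list into a linear preorder on points; a point outside all
    pieces gets rank [size s]. *)
Definition rk s (x : T) := find (fun p => `[< p.2 x >]) s.
Arguments rk : simpl never.

Lemma parts_cat w w' s s' : parts w s -> parts w' s' -> w `&` w' `<=` set0 ->
  parts (w `|` w') (s ++ s').
Proof.
elim: s w => [|p s IH] w /=; first by move=> -> ? _; rewrite set0U.
move=> [pw ps] ps' ww'; split; first by move=> x /pw; left.
have -> : (w `|` w') `\` p.2 = (w `\` p.2) `|` w'.
  apply/seteqP; split=> x /=.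
    by case=> -[] ? ?; [left|right].
  by case=> [[? ?]|w'x]; split; [by left|by []|by right|move=> /pw wx; exact: (ww' x)].
by apply: IH => // x [[wx _] w'x]; apply: (ww' x).
Qed.

Lemma parts_sub w s p : parts w s -> p \in s -> p.2 `<=` w.
Proof.
elim: s w => [|q s IH] w //= [qw qs]; rewrite inE => /orP[/eqP->//|/(IH _ qs) pw].
by move=> x /pw [].
Qed.

Lemma rk_cons p s x :
  rk (p :: s) x = if pselect (p.2 x) then 0 else (rk s x).+1.
Proof. by rewrite /rk /=; case: pselect => px; rewrite ?(asboolT px) ?(asboolF px). Qed.

Lemma parts_rk w s x : parts w s -> w x -> rk s x < size s.
Proof.
elim: s w => [|p s IH] w; first by move=> -> [].
by move=> [pw ps] wx; rewrite rk_cons; case: pselect => //= px; apply: (IH _ ps).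
Qed.

Lemma rk_cat w s s' x : parts w s ->
  rk (s ++ s') x = if pselect (w x) then rk s x else size s + rk s' x.
Proof.
elim: s w => [|p s IH] w; first by move=> ->; case: pselect.
move=> [pw ps]; rewrite cat_cons !rk_cons (IH _ ps).
case: (pselect (p.2 x)) => px /=.
  by case: (pselect (w x)) => // nwx; case: nwx; exact: pw.
case: (pselect (w x)) => wx; case: (pselect ((w `\` p.2) x)) => wpx //=.
  by case: wpx; split.
by case: wx; case: wpx.
Qed.

Lemma parts_nth w s x p0 : parts w s -> rk s x < size s ->
  (nth p0 s (rk s x)).2 x.
Proof.
move=> _ H; have := @nth_find _ p0 (fun p => `[< p.2 x >]) s.
by rewrite has_find => /(_ H) /asboolP.
Qed.

Lemma parts_rkE w s i x p0 : parts w s -> i < size s ->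
  (nth p0 s i).2 x -> rk s x = i.
Proof.
elim: s w i => [|p s IH] w //= [|i] [pw ps] /=; rewrite rk_cons; case: pselect => //.
  move=> px lis /(parts_sub ps (mem_nth _ _)) H.
  by have [] := H lis.
by move=> npx lis; move/(IH _ _ ps lis) ->.
Qed.

(** Ranks in the refined list compare lexicographically: first by the old piece, then by the rank
    inside the partition of this piece. *)
Lemma rk_flatten w s (f : piece -> seq piece) : parts w s ->
  (forall p, p \in s -> parts p.2 (f p)) ->
  let s' := flatten (map f s) in
  parts w s' /\ forall x y, w x -> w y ->
    (rk s y < rk s x -> rk s' y < rk s' x) /\
    (rk s y = rk s x -> exists p, [/\ p \in s, p.2 x, p.2 y &
       (rk s' y < rk s' x) = (rk (f p) y < rk (f p) x)]).
Proof.
elim: s w => [|p s IH] w /=; first by move=> -> _; split.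
move=> [pw ps] H.
have Hp : parts p.2 (f p) by apply: H; rewrite inE eqxx.
have [|ps' IHr] := IH _ ps; first by move=> q qs; apply: H; rewrite inE qs orbT.
split.
  have -> : w = p.2 `|` (w `\` p.2).
    apply/seteqP; split=> x /=; last by case=> [/pw//|[]].
    by have [px|px] := pselect (p.2 x); [left|right].
  by apply: parts_cat => // x [px []].
move=> x y wx wy; rewrite !rk_cons !(rk_cat _ _ Hp).
case: (pselect (p.2 x)) => px; case: (pselect (p.2 y)) => py; split=> //.
- by move=> _; exists p; rewrite inE eqxx.
- by move=> _; apply: (leq_trans (parts_rk Hp py)); rewrite leq_addr.
- rewrite ltnS ltn_add2l; by case: (IHr x y).
- have [] := IHr x y; rewrite //=.
  move=> _ Hq [/Hq[q [qs qx qy e]]]; exists q; split=> //; first by rewrite inE qs orbT.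
  by rewrite ltn_add2l.
Qed.

End OrderedPartition.

Section Steps.
Context (T : Type) (R : set (set T)) (good : set (set T)).

Inductive steps : set T -> set T -> Prop :=
| steps_refl d : steps d d
| steps_cons d d1 d' : R d1 -> d `<=` d1 -> good (d1 `\` d) -> steps d1 d' ->
    steps d d'.

Lemma steps_le d d' : steps d d' -> d `<=` d'.
Proof.
by elim=> [e|e e1 e' _ ee1 _ _]; [exact: subset_refl|exact: subset_trans].
Qed.

Lemma steps_trans d d1 d' : steps d d1 -> steps d1 d' -> steps d d'.
Proof.
by elim=> // e e1 e' Re1 ee1 ge1 _ IH /IH; exact: steps_cons.
Qed.

Hypothesis goodW : forall e e', e `<=` e' -> good e' -> good e.
Hypothesis RU : forall d d', R d -> R d' -> R (d `|` d').
Hypothesis RI : forall d d', R d -> R d' -> R (d `&` d').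

(** Join every set of the chain with [a] and intersect with [b]; consecutive differences only
    shrink. *)
Lemma steps_clip a b : R a -> R b -> a `<=` b -> steps set0 setT -> steps a b.
Proof.
move=> Ra Rb ab st.
have : steps ((set0 `|` a) `&` b) ((setT `|` a) `&` b).
  elim: st => [d|d d1 d' Rd1 dd1 gd _ IH]; first exact: steps_refl.
  apply: (@steps_cons _ ((d1 `|` a) `&` b)) => //.
  - by apply: RI => //; exact: RU.
  - by move=> x [[/dd1|] ? ?]; split; [left| |right|].
  - apply: goodW gd => x [[[d1x|ax] bx] nx]; split => //; try by move=> dx;
    apply: nx; split=> //; left.
      by case: nx; split=> //; right.
by rewrite set0U setTU setTI (setIidl ab).
Qed.

End Steps.

(* [H k c x] says that [c] belongs to the [k]-th chain and that [c] is cut at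
   the point [x]; the elements of [R k] separate the members of that chain. *)
Section RefiningPartitions.
Context (T : Type) (S0 : set (set T)) (R : nat -> set (set T))
  (H : nat -> set T -> T -> Prop).
Notation piece := (option nat * set T)%type.

Definition hits i := [set x | exists c, H i c x].
Definition miss i (e : set T) := forall x, hits i x -> ~ e x.
Definition good i w (e : set T) := [\/ miss i e, e `<=` w | e `<=` ~` w].

Hypothesis algS0 : ba_subalgebra S0.
Hypothesis RS0 : forall i, R i `<=` S0.
Hypothesis RU : forall i d d', R i d -> R i d' -> R i (d `|` d').
Hypothesis RI : forall i d d', R i d -> R i d' -> R i (d `&` d').
Hypothesis HR : forall i c x d, H i c x -> R i d ->
  (d x /\ c `<=` d) \/ (~ d x /\ d `<=` c).
Hypothesis R0 : forall i, R i set0.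
Hypothesis Hsteps : forall i w, S0 w -> steps (R i) (good i w) set0 setT.

Lemma missW i e e' : e `<=` e' -> miss i e' -> miss i e.
Proof. by move=> ee' m x Xx /ee'; exact: m. Qed.

Lemma goodW i w e e' : e `<=` e' -> good i w e' -> good i w e.
Proof.
move=> ee' [m|m|m]; [constructor 1|constructor 2|constructor 3].
- exact: missW m.
- exact: subset_trans m.
- exact: subset_trans m.
Qed.

(* A label [Some k] marks an interval of [R k] meeting the points of [H k]. *)
Definition inv n (p : piece) := S0 p.2 /\
  if p.1 is Some k then
    [/\ exists d d', [/\ R k d, R k d', d `<=` d' & p.2 = d' `\` d],
        ~ miss k p.2 & forall i, i < k -> miss i p.2]
  else forall i, i < n -> miss i p.2.

(** Walk along a chain in [R n] whose differences are decided by [e] or miss the points of the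
    [n]-th chain. A difference that misses them is cut down to [e] and left unlabelled; any other
    one is labelled [n] if inside [e] and dropped if outside. *)
Lemma split_none n e : S0 e -> (forall i, i < n -> miss i e) ->
  exists2 s, parts e s & forall p, p \in s -> inv n.+1 p.
Proof.
move=> Se me.
(* The two trivial ends are made explicit, to be generalized in the induction along the chain. *)
have [s] : exists2 s, parts (e `&` (setT `\` set0)) s &
    forall p, p \in s -> inv n.+1 p; last first.
  by rewrite setD0 setIT; exists s.
have : R n set0 by [].
elim: (Hsteps n Se) => [d|d d1 d' Rd1 dd1 gd st IH] Rd.
  by exists [::] => //=; rewrite setDv setI0.
have d1d' := steps_le st.
have [//|s ps sI] := IH.
pose g := d1 `\` d.
have Sg : S0 g by apply: (alg_setD algS0); exact: (@RS0 n).
have [mg|mg] := pselect (miss n g).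
  exists ((None, e `&` g) :: s) => /=.
    split; first by move=> x [ex [d1x dx]]; split=> //; split=> //; exact: d1d'.
    rewrite (_ : _ `\` _ = e `&` (d' `\` d1)) //.
    apply/seteqP; split=> x /=.
      move=> [[ex [d'x dx]] nx]; split=> //; split=> // d1x; exact: nx.
    by move=> [ex [d'x d1x]]; split; [split=> //; split=> // /dd1|move=> [_ []]].
  move=> p; rewrite inE => /orP[/eqP->|/sI//]; split=> /=;
    first exact: (alg_setI algS0).
  move=> i; rewrite ltnS leq_eqVlt => /orP[/eqP->|/me mi].
    by apply: missW mg => x [].
  by apply: missW mi => x [].
case: gd => [//|ge|ge].
  exists ((Some n, g) :: s) => /=.
    split; first by move=> x gx; split; [exact: ge|case: gx => d1x dx; split=> //;
      exact: d1d'].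
    rewrite (_ : _ `\` _ = e `&` (d' `\` d1)) //.
    apply/seteqP; split=> x /=.
      by move=> [[ex [d'x dx]] nx]; split=> //; split=> // d1x; apply: nx.
    by move=> [ex [d'x d1x]]; split; [split=> //; split=> // /dd1|move=> []].
  move=> p; rewrite inE => /orP[/eqP->|/sI//]; split=> //=; split=> //.
    by exists d, d1.
  by move=> i /me; apply: missW.
exists s => //.
rewrite (_ : e `&` _ = e `&` (d' `\` d1)) //.
apply/seteqP; split=> x [ex [d'x dx]]; split=> //; split=> //.
  by move=> d1x; exact: (ge x).
by move=> /dd1.
Qed.

Lemma parts_flatten (w : set T) (s : seq piece) (Q : piece -> Prop) : parts w s ->
  (forall p, p \in s -> exists2 s', parts p.2 s' & forall q, q \in s' -> Q q) ->
  exists2 s', parts w s' & forall q, q \in s' -> Q q.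
Proof.
elim: s w => [|p s IH] w /=; first by move=> ->; exists [::].
move=> [pw ps] Hs.
have [|s1 ps1 H1] := Hs p; first by rewrite inE eqxx.
have [|s2 ps2 H2] := IH _ ps; first by move=> q qs; apply: Hs; rewrite inE qs orbT.
exists (s1 ++ s2); last by move=> q; rewrite mem_cat => /orP[/H1|/H2].
have -> : w = p.2 `|` (w `\` p.2).
  apply/seteqP; split=> x /=; last by case=> [/pw//|[]].
  by have [px|px] := pselect (p.2 x); [left|right].
by apply: parts_cat => // x [px []].
Qed.

Lemma split_general n e : S0 e ->
  exists2 s, parts e s & forall p, p \in s -> inv n p.
Proof.
move=> Se; elim: n => [|n [s ps sI]].
  exists [:: (None, e)] => /=; first by split=> //; exact: setDv.
  by move=> p; rewrite inE => /eqP->; split.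
apply: (parts_flatten ps) => -[[k|] e'] /sI ip.
  exists [:: (Some k, e')]; first by split; [exact: subset_refl|exact: setDv].
  by move=> p; rewrite inE => /eqP->.
by case: ip => /= Se' me'; exact: split_none.
Qed.

Lemma split_decide n e u : S0 e -> S0 u -> exists2 s, parts e s &
  forall p, p \in s -> inv n p /\ (p.2 `<=` u \/ p.2 `<=` ~` u).
Proof.
move=> Se Su.
have [s ps sI] := split_general n (alg_setI algS0 Se Su).
have [s' ps' is'] := split_general n (alg_setD algS0 Se Su).
exists (s ++ s'); last first.
  move=> p; rewrite mem_cat => /orP[] /[dup] psi.
    move/sI => ip; split=> //; left=> x px.
    by have [] := parts_sub ps psi px.
  move/is' => ip; split=> //; right=> x px.
  by have [] := parts_sub ps' psi px.
have -> : e = (e `&` u) `|` (e `\` u) by rewrite setUIDK.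
by apply: parts_cat => // x [[_ ux] [_]].
Qed.

(** A labelled piece is cut along a chain in its own [R k]. Since members of the [k]-th chain are
    comparable with these cuts, the new pieces before that of a cut point lie inside the member, and
    those after it lie outside. *)
Lemma refine n p u : inv n p -> S0 u -> exists s, [/\ parts p.2 s,
  forall q, q \in s -> inv n.+1 q /\ (q.2 `<=` u \/ q.2 `<=` ~` u) &
  forall k, p.1 = Some k -> forall c x, H k c x -> p.2 x -> forall y, p.2 y ->
    (rk s y < rk s x -> c y) /\ (rk s x < rk s y -> ~ c y)].
Proof.
case: p => -[k|] e [/= Se]; last first.
  move=> _ Su; have [s ps sI] := split_decide n.+1 Se Su.
  by exists s; split.
move=> [[d [d' [Rd Rd' dd' eE]]] _ me] Su.
have [s [ps sI hs]] : exists s, [/\ parts (d' `\` d) s,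
  forall q, q \in s -> inv n.+1 q /\ (q.2 `<=` u \/ q.2 `<=` ~` u) &
  forall c x, H k c x -> (d' `\` d) x -> forall y, (d' `\` d) y ->
    (rk s y < rk s x -> c y) /\ (rk s x < rk s y -> ~ c y)]; last first.
  by exists s; rewrite /= eE; split; [|exact: sI|move=> _ [<-]].
have st : steps (R k) (good k u) d d'.
  by apply: steps_clip => //; [exact: goodW|exact: RU|exact: RI|exact: Hsteps].
rewrite {}eE {e} in Se me; move: Rd me {Se dd' Rd'}.
elim: st => {d d'} [d|d d1 d' Rd1 dd1 gd st IH] Rd me.
  by exists [::]; split; [exact: setDv| |move=> c x _ []].
have d1d' := steps_le st.
have [//||s [ps sI hs]] := IH.
  by move=> i /me; apply: missW => x [d'x d1x]; split=> // /dd1.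
pose g := d1 `\` d.
have Sg : S0 g by apply: (alg_setD algS0); exact: (@RS0 k).
have gE : d' `\` d = g `|` (d' `\` d1).
  apply/seteqP; split=> x /=.
    by move=> [d'x dx]; have [|] := pselect (d1 x); [left|right].
  by case=> [[d1x dx]|[d'x d1x]]; split; [exact: d1d'| | |move=> /dd1].
have gdis : g `&` (d' `\` d1) `<=` set0 by move=> x [[? _] []].
(* A step that contains a cut point stays a single piece, already decided by [u]; only steps without
   cut points are split freely. *)
have [s1 [ps1 is1 hs1]] : exists s1, [/\ parts g s1,
  forall q, q \in s1 -> inv n.+1 q /\ (q.2 `<=` u \/ q.2 `<=` ~` u) &
  forall c x, H k c x -> g x -> rk s1 x = 0 /\ size s1 = 1].
  have [mg|mg] := pselect (miss k g).
    have [s1 ps1 is1] := split_decide n.+1 Sg Su.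
    by exists s1; split=> // c x Hx gx; case: (mg x) => //; exists c.
  exists [:: (Some k, g)]; split; first by split; [exact: subset_refl|exact: setDv].
    move=> q; rewrite inE => /eqP->; split; last by case: gd => //; [left|right].
    split=> //=; split=> //; first by exists d, d1.
    by move=> i /me; apply: missW => x gx; rewrite gE; left.
  by move=> c x _ gx; split=> //; rewrite rk_cons; case: pselect.
exists (s1 ++ s); split.
- by rewrite gE; exact: parts_cat.
- by move=> q; rewrite mem_cat => /orP[/is1|/sI].
- move=> c x Hx dx y dy; rewrite !(rk_cat _ _ ps1).
  (* If [x] is in [d1], its piece is [g] itself and all later pieces are outside [c]. Otherwise [g]
     precedes [x] and lies inside [c], and the rest is the induction hypothesis. *)
  have [[d1x cd1]|[nd1x d1c]] := HR Hx Rd1.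
    have gx : g x by split=> //; case: dx.
    case: (pselect (g x)) => [gx'|//] /=; have [-> s11] := hs1 _ _ Hx gx.
    split=> //; case: pselect => [gy|ngy] /=.
      by have := parts_rk ps1 gy; rewrite s11 ltnS leqn0 => /eqP->.
    by move=> _ /cd1 d1y; apply: ngy; split=> //; case: dy.
  case: (pselect (g x)) => [[//]|ngx] /=.
  case: (pselect (g y)) => [gy|ngy] /=.
    split=> [_|]; first by apply: d1c; case: gy.
    by move=> /ltn_trans /(_ (parts_rk ps1 gy)); rewrite -ltn_subRL subnn ltn0.
  rewrite !ltn_add2l; apply: hs => //.
    by split=> //; case: dx.
  by move: dy; rewrite gE => -[].
Qed.

Lemma refining_partitions (v : nat -> set T) : (forall n, S0 (v n)) ->
  exists P : nat -> seq piece, forall n, [/\ parts setT (P n),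
    forall p, p \in P n -> inv n p,
    forall p, p \in P n.+1 -> p.2 `<=` v n \/ p.2 `<=` ~` v n,
    forall x y, rk (P n) y < rk (P n) x -> rk (P n.+1) y < rk (P n.+1) x &
    forall x y c k, H k c x -> rk (P n) y = rk (P n) x ->
      (nth (None, set0) (P n) (rk (P n) x)).1 = Some k ->
      (rk (P n.+1) y < rk (P n.+1) x -> c y) /\
      (rk (P n.+1) x < rk (P n.+1) y -> ~ c y)].
Proof.
move=> Sv.
have /choice[ref refP] : forall np : nat * piece, exists s, inv np.1 np.2 ->
    [/\ parts np.2.2 s,
  forall q, q \in s -> inv np.1.+1 q /\ (q.2 `<=` v np.1 \/ q.2 `<=` ~` v np.1) &
  forall k, np.2.1 = Some k -> forall c x, H k c x -> np.2.2 x ->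
    forall y, np.2.2 y ->
    (rk s y < rk s x -> c y) /\ (rk s x < rk s y -> ~ c y)].
  move=> [n p]; have [ip|nip] := pselect (inv n p); last by exists [::] => /= /nip.
  by have [s Hs] := refine ip (Sv n); exists s.
have ref_parts n p : inv n p -> parts p.2 (ref (n, p)) by move=> ip;
  case: (refP (n, p) ip).
pose P := fix P n := if n is m.+1 then
  flatten (map (fun p => ref (m, p)) (P m)) else [:: (None, setT) : piece].
have base n : parts setT (P n) /\ forall p, p \in P n -> inv n p.
  elim: n => [|n [pP iP]] /=.
    split; first by rewrite setDv.
    by move=> p; rewrite inE => /eqP->; split=> //; exact: alg_setT algS0.
  have [p' _] := rk_flatten (f := fun p => ref (n, p)) pP (fun p pp
    => ref_parts n p (iP p pp)).
  split=> // q /flattenP[s /mapP[p pP' ->]] qs.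
  by have [_ /(_ _ qs) [] ] := refP (n, p) (iP p pP').
exists P => n; have [pP iP] := base n.
have [p' H'] := rk_flatten (f := fun p => ref (n, p)) pP (fun p pp
  => ref_parts n p (iP p pp)).
split=> //.
- move=> q /flattenP[s /mapP[p pP' ->]] qs.
  by have [_ /(_ _ qs) [] ] := refP (n, p) (iP p pP').
- by move=> x y; exact: (H' x y I I).1.
- move=> x y c k Hx e lab.
  have [p [pp px py e1]] := (H' x y I I).2 e.
  have [q [qp qy qx e2]] := (H' y x I I).2 (esym e).
  have xs := parts_rk pP (I : [set: T] x).
  have nthE r : r \in P n -> r.2 x -> nth (None, set0) (P n) (rk (P n) x) = r.
    move=> /(nthP (None, set0)) [i ip <-] rx.
    by rewrite (parts_rkE pP ip rx).
  have pq : p = q by rewrite -(nthE p) // -(nthE q).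
  subst q; have [_ _ hp] := refP (n, p) (iP p pp).
  rewrite (nthE p) // in lab.
  by have := hp _ lab _ _ Hx px _ py; rewrite /= -e1 -e2.
Qed.

End RefiningPartitions.

(** * One chain out of countably many separated chains *)

Section ChainFromFamilies.
Context (T : Type) (S S0 : set (set T)) (R : nat -> set (set T))
  (H : nat -> set T -> T -> Prop).
Hypothesis algS : ba_subalgebra S.
Hypothesis algS0 : ba_subalgebra S0.
Hypothesis S0S : S0 `<=` S.
Hypothesis countS0 : countable S0.
Hypothesis RS0 : forall i, R i `<=` S0.
Hypothesis RU : forall i d d', R i d -> R i d' -> R i (d `|` d').
Hypothesis RI : forall i d d', R i d -> R i d' -> R i (d `&` d').
Hypothesis R0 : forall i, R i set0.
Hypothesis HS : forall i c x, H i c x -> S c.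
Hypothesis Hchain : forall i c x c' x', H i c x -> H i c' x' ->
  c `<=` c' \/ c' `<=` c.
Hypothesis HR : forall i c x d, H i c x -> R i d ->
  (d x /\ c `<=` d) \/ (~ d x /\ d `<=` c).
Hypothesis Hsteps : forall i w, S0 w -> steps (R i) (good H i w) set0 setT.

(* Members whose cut point is not a limit of the cut points of earlier chains:
   the point is eventually in a piece carrying the label of its own chain. *)
Definition separated_members := [set c | exists i x, H i c x /\
  exists w, [/\ S0 w, w x & forall j, j < i -> miss H j w]].

Hypothesis genS : S `<=` ba_generated (S0 `|` separated_members).

(** The chain consists of all initial segments of the ordered partitions, together with one initial
    segment for each member whose point has a stable label: the pieces before the point, and the
    part of the member in the piece of the point. *)
Lemma chain_from_families :
  exists C, [/\ is_chain C, C `<=` S & S `<=` ba_generated C].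
Proof.
have [v Sv vS0] := countable_enum countS0 (alg_set0 algS0).
have [P HP] := refining_partitions algS0 RS0 RU RI HR R0 Hsteps Sv.
pose r n x := rk (P n) x.
have pP n : parts setT (P n) by case: (HP n).
have rS n x : r n x < size (P n) by exact: parts_rk (pP n) I.
pose pc n x := nth (None, set0) (P n) (r n x).
have pcP n x : pc n x \in P n by rewrite mem_nth.
have pcE n x : (pc n x).2 = [set y | r n y = r n x].
  apply/seteqP; split=> y /=; first by move=> /(parts_rkE (pP n) (rS n x)).
  by move=> e; rewrite /pc -e; exact: parts_nth (pP n) (rS n y).
have r_mono n m x y : n <= m -> r n y < r n x -> r m y < r m x.
  move=> /subnK <-; elim: (m - n) => [//|k IH] /IH.
  by case: (HP (k + n)) => _ _ _ + _; exact.
have r_mono' n m x y : n <= m -> r m y <= r m x -> r n y <= r n x.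
  by move=> nm; rewrite leqNgt => rm; rewrite leqNgt; apply: contra rm; exact: r_mono.
have r_eq n m x y : n <= m -> r m y = r m x -> r n y = r n x.
  move=> nm e; apply/eqP; rewrite eqn_leq.
  by rewrite !(r_mono' n m) // ?e.
have lvlS0 n j : S0 [set y | r n y = j].
  have [[x <-]|nx] := pselect (exists x, r n x = j).
    by rewrite -pcE; case: (HP n) => _ /(_ _ (pcP n x)) [].
  rewrite (_ : mkset _ = set0); first exact: alg_set0 algS0.
  by apply/seteqP; split=> x //= e; apply: nx; exists x.
have lowS0 n j : S0 [set y | r n y < j].
  rewrite (_ : mkset _ = [set y | exists i, [/\ i \in iota 0 j, True
    & [set y | r n y = i] y]]).
    by apply: (alg_bigU algS0).
  apply/seteqP; split=> y /=.
    by move=> ryj; exists (r n y); rewrite mem_iota.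
  by move=> [i []]; rewrite mem_iota => ij _ ->.
pose settled n x k := forall m, n <= m -> (pc m x).1 = Some k.
(* Once [w] has been decided, the piece of [x] lies inside [w]. Its label is not below [k], since a
   labelled piece hits its own chain, and not above [k], since it misses all earlier chains. *)
have settledP c : separated_members c -> exists n x k, H k c x /\ settled n x k.
  move=> [k [x [Hx [w [Sw wx mw]]]]]; have [n0 vw] := vS0 w Sw.
  exists (maxn n0.+1 k.+1), x, k; split=> // m; rewrite geq_max => /andP[n0m km].
  have [_ /(_ _ (pcP m x)) [_] im _ _ _] := HP m.
  have pcw : (pc m x).2 `<=` w.
    rewrite pcE => y /= /(r_eq n0.+1) -/(_ n0m) e.
    have [_ _ /(_ _ (pcP n0.+1 x)) + _ _] := HP n0.
    rewrite pcE vw => -[H1|H1]; first exact: H1.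
    by case: (H1 x).
  have xk : hits H k x by exists c.
  have pcx : (pc m x).2 x by rewrite pcE.
  case: (pc m x).1 im => [j|] im; last by case: (im k km x xk).
  case: im => _ mj mi; congr Some.
  case: (ltngtP j k) => // [jk|kj].
    by case: mj; apply: missW (mw j jk).
  by case: (mi k kj x xk).
(* This does not depend on the level: a refinement moves before the piece of [x] only points of [c],
   and after it only points outside [c]. *)
pose hat n c x := [set y | r n y < r n x] `|` ([set y | r n y = r n x] `&` c).
have hatE n m c x k : n <= m -> H k c x -> settled n x k -> hat n c x = hat m c x.
  move=> /subnK <- Hx st; elim: (m - n) => [//|i ->].
  have [_ _ _ _ hp] := HP (i + n).
  have lab : (pc (i + n) x).1 = Some k by apply: st; rewrite leq_addl.
  apply/seteqP; split=> y /=.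
    case=> [lt|[e cy]]; first by left; exact: r_mono lt.
    have [h1 h2] := hp x y c k Hx e lab.
    have [lt|lt|e'] := ltngtP (r (i.+1 + n) y) (r (i.+1 + n) x); [by left| |by right].
    by case: (h2 lt).
  case=> [lt|[/(r_eq (i + n)) -/(_ (leqnSn _)) e cy]]; last by right.
  have := r_mono' (i + n) (i.+1 + n) _ _ (leqnSn _) (ltnW lt).
  rewrite leq_eqVlt => /orP[/eqP e|]; last by left.
  by right; split=> //; exact: (hp x y c k Hx e lab).1.
pose C : set (set T) := [set u | (exists n j, u = [set y | r n y < j]) \/
  exists n c x k, [/\ H k c x, settled n x k & u = hat n c x]].
have down n m j x y : n <= m -> r m y <= r m x -> r n x < j -> r n y < j.
  by move=> nm /(r_mono' n) -/(_ nm); exact: leq_ltn_trans.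
have hatS n c x k : H k c x -> S (hat n c x).
  move=> Hx; apply: (alg_setU algS); first exact: S0S.
  by apply: (alg_setI algS); [exact: S0S|exact: HS Hx].
exists C; split.
- have ch1 n j m i : n <= m -> [set y | r n y < j] `<=` [set y | r m y < i] \/
      [set y | r m y < i] `<=` [set y | r n y < j].
    move=> nm; have [h|h] := pselect ([set y | r m y < i] `<=` [set y | r n y < j]).
      by right.
    left=> y /= ry; rewrite ltnNge; apply/negP => le; apply: h => z /= rz.
    by apply: (down n m j y z) => //; apply: ltnW; exact: leq_trans le.
  have ch2 n c x k m i : H k c x -> settled n x k ->
      hat n c x `<=` [set y | r m y < i] \/ [set y | r m y < i] `<=` hat n c x.
    move=> Hx st; rewrite (@hatE n (maxn n m) c x k) ?leq_maxl //.
    have mM := leq_maxr n m.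
    have [rx|rx] := ltnP (r m x) i; [left=> y|right=> y /= ry].
      by case=> [/= lt|[/= e _]]; apply: (down m _ i x y mM) => //;
        [exact: ltnW|rewrite e].
    left => /=; rewrite ltnNge; apply/negP => le.
    by have := down m _ i y x mM le ry; rewrite ltnNge rx.
  move=> u u' [[n [j ->]]|[n [c [x [k [Hx st ->]]]]]]
    [[n' [j' ->]]|[n' [c' [x' [k' [Hx' st' ->]]]]]].
  + have [nn|nn] := leqP n n'; first exact: ch1.
    by case: (ch1 n' j' n j (ltnW nn)); [right|left].
  + by case: (ch2 n' c' x' k' n j Hx' st'); [right|left].
  + exact: ch2 st.
  + pose m := maxn n n'.
    rewrite (@hatE n m c x k) ?leq_maxl // (@hatE n' m c' x' k') ?leq_maxr //.
    have [lt|lt|e] := ltngtP (r m x) (r m x').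
    * by left=> y [/= ry|[/= e _]]; left; rewrite /= ?e //; exact: ltn_trans lt.
    * by right=> y [/= ry|[/= e _]]; left; rewrite /= ?e //; exact: ltn_trans lt.
    (* A common piece has one label, so both members belong to the same chain. *)
    * have kk : k = k'.
        have := st m (leq_maxl _ _); rewrite /pc e st' ?leq_maxr //.
        by case.
      subst k'; rewrite /hat e.
      by have [cc|cc] := Hchain Hx Hx'; [left|right] => y [?|[? /cc ?]];
        [left|right|left|right].
- move=> u [[n [j ->]]|[n [c [x [k [Hx st ->]]]]]]; first exact: S0S.
  exact: hatS Hx.
- have algC := generated_alg C.
  have lowC n j : ba_generated C [set y | r n y < j].
    by apply: generated_incl; left; exists n, j.
  have lvlC n j : ba_generated C [set y | r n y = j].
    rewrite (_ : mkset _ = [set y | r n y < j.+1] `\` [set y | r n y < j]).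
      exact: (alg_setD algC).
    apply/seteqP; split=> y /=; first by move=> ->; rewrite ltnS leqnn ltnn.
    by rewrite ltnS => -[le /negP]; rewrite -leqNgt => ge; apply/eqP;
      rewrite eqn_leq le ge.
  have S0C : S0 `<=` ba_generated C.
    move=> u /vS0 [n <-].
    rewrite (_ : v n = [set y | exists i, [/\ i \in iota 0 (size (P n.+1)),
        [set y | r n.+1 y = i] `<=` v n & [set y | r n.+1 y = i] y]]).
      by apply: (alg_bigU algC).
    apply/seteqP; split=> y /=; last by move=> [i [_ H1 H2]]; exact: H1.
    move=> vy; exists (r n.+1 y); split=> //; first by rewrite mem_iota /= add0n rS.
    have [_ _ /(_ _ (pcP n.+1 y)) + _ _] := HP n.
    by rewrite pcE => -[//|/(_ y erefl)].
  apply: subset_trans genS _; apply: generated_sub => // u [/S0C//|].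
  move=> /[dup] cu /settledP [n [x [k [Hx st]]]].
  have [_ /(_ _ (pcP n x)) [_] im _ _ _] := HP n.
  (* The piece of [x] is a difference of two sets in [R k] that enclose [u], so [u] can be recovered
     from its hat within this piece. *)
  move: im; rewrite st // => -[[d [d' [Rd Rd' dd' pE]]] _ _].
  have xp : (d' `\` d) x by rewrite -pE pcE.
  have du : d `<=` u by case: (HR Hx Rd) => -[] // dx; case: xp.
  have ud' : u `<=` d' by case: (HR Hx Rd') => -[] // dx; case: xp.
  have hC : ba_generated C (hat n u x).
    by apply: generated_incl; right; exists n, u, x, k.
  rewrite (_ : u = d `|` (hat n u x `&` [set y | r n y = r n x])).
    by apply: (alg_setU algC); [apply: S0C; exact: (@RS0 k)|exact: (alg_setI algC)].
  rewrite -pcE pE; apply/seteqP; split=> y.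
    move=> uy; have [dy|dy] := pselect (d y); [by left|right].
    have ry : (d' `\` d) y by split=> //; exact: ud'.
    split=> //; right; split=> //.
    by have : (pc n x).2 y; [rewrite pE|rewrite pcE].
  case=> [/du//|[[/= lt|[]//] ry]].
  have : (pc n x).2 y by rewrite pE.
  by rewrite pcE /= => e; rewrite e ltnn in lt.
Qed.

End ChainFromFamilies.

(** * Jumps *)

Section Prefix.
Implicit Types (x y z : lex2) (N M : nat).

Definition pre N x : {ffun 'I_N -> bool} := [ffun i : 'I_N => (x : nat -> bool) i].

Lemma preP N x y : pre N x = pre N y <-> forall i, i < N -> x i = y i.
Proof.
split=> [/ffunP H i iN|H]; last by apply/ffunP => i; rewrite !ffunE H.
by have := H (Ordinal iN); rewrite !ffunE.
Qed.

Lemma preW N M x y : N <= M -> pre M x = pre M y -> pre N x = pre N y.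
Proof.
by move=> NM /preP H; apply/preP => i iN; apply: H; exact: leq_trans NM.
Qed.

Lemma pre_sep x y : x != y -> exists N, pre N x <> pre N y.
Proof.
move=> /eqP xy; apply: contrapT => H; apply: xy; apply/funext => i.
have : pre i.+1 x = pre i.+1 y by apply: contrapT => h; apply: H; exists i.+1.
by move/preP; apply.
Qed.

Lemma pre_conv N x y z : (x <= y)%O -> (y <= z)%O -> pre N x = pre N z ->
  pre N y = pre N x.
Proof.
move=> xy yz /preP H.
have := @big_lexi_order_between _ (fun=> bool) x y z N.
rewrite xy yz => /(_ isT) h; apply/preP => i iN.
by apply: h => // j jN; apply: H.
Qed.

(** Cylinders are convex, so two different ones of equal length are ordered like any of their
    points. *)
Lemma pre_lt N x y x' y' : (x < y)%O -> pre N x <> pre N y ->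
  pre N x' = pre N x -> pre N y' = pre N y -> (x' < y')%O.
Proof.
move=> xy ne ex ey; rewrite ltNge; apply/negP => yx'.
have [x'y|yx''] := leP x' y.
  by apply: ne; rewrite -ex -ey; exact: pre_conv yx' x'y ey.
by apply: ne; apply/esym; exact: pre_conv (ltW xy) (ltW yx'') (esym ex).
Qed.

End Prefix.

Section Jumps.
Context (L : set lex2).
Notation Om := (set_type L).

Lemma le_val (x y : Om) : (val x <= val y)%O = (x <= y)%O.
Proof. by rewrite leEsub. Qed.

Lemma lt_val (x y : Om) : (val x < val y)%O = (x < y)%O.
Proof. by rewrite ltEsub. Qed.

Lemma pr_conv N (x y z : Om) : (x <= y)%O -> (y <= z)%O ->
  pre N (val x) = pre N (val z) -> pre N (val y) = pre N (val x).
Proof. by rewrite -!le_val; exact: pre_conv. Qed.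

Hypothesis left_dense : forall (f : Om) N,
  exists2 y : Om, (y < f)%O & pre N (val y) = pre N (val f).
Implicit Types (u v w : set Om) (x y z f a b : Om).

(** The interval []x, y]] is closed on the right because a final ray contains its end point: the
    value changes on arriving at [a]. *)
Definition jumps_in u (A : seq Om) := forall x y, (x <= y)%O ->
  (forall a, a \in A -> ~~ (x < a <= y)%O) -> (u x <-> u y).
Definition fin_jumps u := exists A, jumps_in u A.
(* Elements of [calB] are continuous from the right, hence only discontinuities
   from the left are counted. *)
Definition jump u f := forall y, (y < f)%O ->
  exists z, [/\ (y <= z)%O, (z < f)%O & ~ (u z <-> u f)].

Lemma not_between x y a : ~~ (x < a <= y)%O = (a <= x)%O || (y < a)%O.
Proof. by rewrite negb_and -leNgt -ltNge. Qed.

Lemma fin_jumps_op u v w :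
  (forall x y, (u x <-> u y) -> (v x <-> v y) -> (w x <-> w y)) ->
  fin_jumps u -> fin_jumps v -> fin_jumps w.
Proof.
move=> H [A HA] [B HB]; exists (A ++ B) => x y xy nAB; apply: H.
  by apply: HA => // a aA; apply: nAB; rewrite mem_cat aA.
by apply: HB => // a aA; apply: nAB; rewrite mem_cat aA orbT.
Qed.

Lemma left_lim u f : fin_jumps u ->
  exists2 y, (y < f)%O & forall z, (y <= z)%O -> (z < f)%O -> (u z <-> u y).
Proof.
move=> [A HA].
have [y yf Hy] : exists2 y, (y < f)%O &
    forall a, a \in A -> (a < f)%O -> (a <= y)%O.
  elim: A {HA} => [|a A [y yf Hy]].
    by have [y yf _] := left_dense f 0; exists y.
  have [af|fa] := ltP a f.
    exists (Order.max a y); first by rewrite gt_max af.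
    move=> b; rewrite inE => /orP[/eqP->|bA] bf; first by rewrite le_max lexx.
    by rewrite le_max Hy ?orbT.
  exists y => // b; rewrite inE => /orP[/eqP->|]; last exact: Hy.
  by rewrite ltNge fa.
exists y => // z yz zf; apply: iff_sym; apply: HA => // a aA.
apply/negP => /andP[ya az]; have := Hy a aA (le_lt_trans az zf).
by rewrite leNgt ya.
Qed.

Lemma jumpE u f y : (y < f)%O ->
  (forall z, (y <= z)%O -> (z < f)%O -> (u z <-> u y)) ->
  jump u f <-> ~ (u y <-> u f).
Proof.
move=> yf Hy; split.
  by move=> /(_ y yf) [z [yz zf nz]] e; apply: nz; rewrite (Hy z).
move=> ne y' y'f; exists (Order.max y y').
rewrite gt_max yf y'f le_max lexx orbT; split=> //.
by rewrite (Hy (Order.max y y')) // ?le_max ?lexx // gt_max yf y'f.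
Qed.

Lemma left_lim2 u v f : fin_jumps u -> fin_jumps v ->
  exists y, [/\ (y < f)%O,
    forall z, (y <= z)%O -> (z < f)%O -> (u z <-> u y) &
    forall z, (y <= z)%O -> (z < f)%O -> (v z <-> v y)].
Proof.
move=> fu fv; have [y yf Hy] := left_lim f fu; have [y' yf' Hy'] := left_lim f fv.
have mf : (Order.max y y' < f)%O by rewrite gt_max yf.
exists (Order.max y y'); split=> // z; rewrite ge_max => /andP[yz y'z] zf.
  by rewrite (Hy z) // (Hy (Order.max y y')) // le_max lexx.
by rewrite (Hy' z) // (Hy' (Order.max y y')) // le_max lexx orbT.
Qed.

(** A jump compares the value at [f] with the constant value just before [f]; if neither [u] nor [v]
    changes there, [w] does not either. *)
Lemma jump_op u v w f :
  (forall x y, (u x <-> u y) -> (v x <-> v y) -> (w x <-> w y)) ->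
  fin_jumps u -> fin_jumps v -> jump w f -> jump u f \/ jump v f.
Proof.
move=> H fu fv jw; have [y [yf Hu Hv]] := left_lim2 f fu fv.
apply: contrapT => /not_orP[nu nv].
have Hw z : (y <= z)%O -> (z < f)%O -> (w z <-> w y).
  by move=> yz zf; apply: H; [exact: Hu|exact: Hv].
apply: ((jumpE yf Hw).1 jw); apply: H.
  by apply: contrapT => ne; apply: nu; apply/(jumpE yf Hu).
by apply: contrapT => ne; apply: nv; apply/(jumpE yf Hv).
Qed.

Definition symd u v : set Om := (u `\` v) `|` (v `\` u).

Lemma symdP u v x : symd u v x <-> ~ (u x <-> v x).
Proof.
rewrite /symd /setU /setD /=; have := pselect (u x); have := pselect (v x); tauto.
Qed.

Lemma symdK u v : symd (symd u v) v = u.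
Proof.
apply/seteqP; split=> x; rewrite !symdP;
have := pselect (u x); have := pselect (v x); tauto.
Qed.

Lemma symd_op u v x y :
  (u x <-> u y) -> (v x <-> v y) -> (symd u v x <-> symd u v y).
Proof. by rewrite !symdP => -> ->. Qed.

Lemma jump_symd u v f : fin_jumps u -> fin_jumps v ->
  jump (symd u v) f <-> ~ (jump u f <-> jump v f).
Proof.
move=> fu fv; have [y [yf Hu Hv]] := left_lim2 f fu fv.
have Hw z : (y <= z)%O -> (z < f)%O -> (symd u v z <-> symd u v y).
  by move=> yz zf; apply: symd_op; [exact: Hu|exact: Hv].
rewrite (jumpE yf Hw) (jumpE yf Hu) (jumpE yf Hv) !symdP.
have := pselect (u f); have := pselect (v f).
have := pselect (u y); have := pselect (v y); tauto.
Qed.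

(** A passage across [a] is divided at a point just before [a], from which [u] does not change up to
    [a], and at [a] itself. *)
Lemma jumps_inN u a A : jumps_in u (a :: A) -> ~ jump u a -> jumps_in u A.
Proof.
move=> HA /existsNP[y0 /not_implyP[y0a /forallNP Hy0]] x y xy nA.
have [/andP[xa ay]|nxy] := boolP (x < a <= y)%O; last first.
  by apply: HA => // b; rewrite inE => /orP[/eqP->|/nA].
have zb : (Order.max x y0 < a)%O by rewrite gt_max xa.
have xz : (x <= Order.max x y0)%O by rewrite le_max lexx.
have -> : u x <-> u (Order.max x y0).
  apply: HA => // b; rewrite inE => /orP[/eqP->|/nA].
    by rewrite not_between zb orbT.
  rewrite !not_between => /orP[->//|yb].
  by have -> : (Order.max x y0 < b)%O by [exact: lt_trans (lt_le_trans zb ay) yb];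
    rewrite orbT.
have -> : u (Order.max x y0) <-> u a.
  apply: contrapT => ne; have h := Hy0 (Order.max x y0).
  by apply: h; split; [rewrite le_max lexx orbT|exact: zb|exact: ne].
apply: HA => // b; rewrite inE => /orP[/eqP->|/nA]; first by rewrite ltxx.
rewrite !not_between => /orP[bx|->]; last by rewrite orbT.
by rewrite (le_trans bx) // ltW.
Qed.

Lemma jump_free u x y : fin_jumps u -> (x <= y)%O ->
  (forall a, (x < a)%O -> (a <= y)%O -> ~ jump u a) -> (u x <-> u y).
Proof.
move=> [A HA] xy nj.
(* The entries of [A] are tested one by one; [B] collects those already found to be jumps. *)
have : forall B, jumps_in u (A ++ B) -> jumps_in u ([seq a <- A | `[< jump u a >]] ++
  B).
  elim: A {HA} => [//|a A IH] B /= HA; case: asboolP => ja.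
    have H : jumps_in u (A ++ (a :: B)).
      move=> z z' zz' nz; apply: HA => // b bA; apply: nz; move: bA.
      by rewrite inE !mem_cat inE orbCA.
    move=> z z' zz' nz; apply: (IH _ H) => // b bA; apply: nz; move: bA.
    by rewrite inE !mem_cat inE orbCA.
  by apply: IH; exact: jumps_inN HA ja.
move=> /(_ [::]); rewrite !cats0 => /(_ HA) H; apply: H => // a.
rewrite mem_filter => /andP[/asboolP ja _]; apply/negP => /andP[xa ay].
exact: nj ja.
Qed.

Lemma jumps_finite u : fin_jumps u -> exists A : seq Om, forall f, jump u f <-> f \in A.
Proof.
move=> fu; have [A HA] := fu; exists [seq a <- A | `[< jump u a >]] => f.
rewrite mem_filter; split; last by move=> /andP[/asboolP].
move=> ju; rewrite (asboolT ju) /=; apply: contrapT => /negP fA.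
have [y yf Hy] : exists2 y, (y < f)%O & forall a, a \in A -> (a < f)%O -> (a <= y)%O.
  elim: A {HA} fA => [_|a A IH].
    by have [y yf _] := left_dense f 0; exists y.
  rewrite inE negb_or => /andP[_ /IH [y yf Hy]].
  have [af|fa] := ltP a f.
    exists (Order.max a y); first by rewrite gt_max af.
    move=> b; rewrite inE => /orP[/eqP->|bA] bf; first by rewrite le_max lexx.
    by rewrite le_max Hy ?orbT.
  exists y => // b; rewrite inE => /orP[/eqP->|]; last exact: Hy.
  by rewrite ltNge fa.
have [z [yz zf]] := ju y yf; apply; apply: HA => [|a aA]; first exact: ltW.
apply/negP => /andP[za]; rewrite le_eqVlt => /orP[/eqP e|af].
  by rewrite -e aA in fA.
by have := Hy a aA af; rewrite leNgt (le_lt_trans yz za).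
Qed.

Lemma jump_local N u v f :
  (forall z, pre N (val z) = pre N (val f) -> (u z <-> v z)) ->
  jump u f -> jump v f.
Proof.
move=> uv ju y yf; have [y1 y1f e1] := left_dense f N.
have [|z []] := ju (Order.max y y1); first by rewrite gt_max yf.
rewrite ge_max => /andP[yz y1z] zf nz; exists z; split=> //.
have ez : pre N (val z) = pre N (val f).
  by rewrite -e1; exact: pr_conv y1z (ltW zf) e1.
by rewrite -!uv.
Qed.

Lemma calB_fin_jumps : calB Om `<=` fin_jumps.
Proof.
apply: generated_sub.
  apply/ba_subalgebra_setP; split.
  - by exists [::].
  - by exists [::].
  - move=> u v; apply: fin_jumps_op => x y; rewrite /setU /=; tauto.
  - move=> u v; apply: fin_jumps_op => x y; rewrite /setI /=; tauto.
  - move=> u fu; apply: (fin_jumps_op _ fu fu) => x y; rewrite /setC /=; tauto.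
move=> _ [a _ <-]; exists [:: a] => x y xy /(_ a); rewrite inE eqxx => /(_ isT).
rewrite not_between /= => /orP[ax|ya]; split=> //.
- by move=> _; exact: le_trans xy.
- by move=> /le_trans /(_ xy).
- by rewrite leNgt ya.
Qed.

End Jumps.

(** * Families of elements with a given pattern of jumps *)

Lemma ex_bound (I : eqType) (s : seq I) (P : I -> nat -> Prop) :
  (forall i M M', M <= M' -> P i M -> P i M') ->
  (forall i, i \in s -> exists M, P i M) -> exists M, forall i, i \in s -> P i M.
Proof.
move=> mono; elim: s => [|i s IH] H; first by exists 0.
have [|M HM] := IH; first by move=> j js; apply: H; rewrite inE js orbT.
have [|M' HM'] := H i; first by rewrite inE eqxx.
exists (maxn M M') => j; rewrite inE => /orP[/eqP->|js].
  by apply: mono HM'; rewrite leq_maxr.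
by apply: mono (HM j js); rewrite leq_maxl.
Qed.

Lemma ex_bound_fin (I : finType) (P : I -> nat -> Prop) :
  (forall i M M', M <= M' -> P i M -> P i M') ->
  (forall i, exists M, P i M) -> exists M, forall i, P i M.
Proof.
move=> mono H; have [|M HM] := @ex_bound I (enum I) P mono; first by move=> i _.
by exists M => i; apply: HM; rewrite mem_enum.
Qed.

(** Compactness for an ideal of small sets. A box that is not small has an extension by one letter
    that is not small, as finitely many extensions cover it; repeating this yields a branch that
    contradicts the last hypothesis. *)
Lemma konig (E : finType) (X : Type) (g : X -> nat -> E) (small : set X -> Prop) :
  small set0 -> (forall A B, small A -> small B -> small (A `|` B)) ->
  (forall A B, A `<=` B -> small B -> small A) ->
  (forall p : nat -> E, exists M, small [set x | forall k, k < M -> g x k = p k]) ->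
  small setT.
Proof.
move=> s0 sU sW Hp; apply: contrapT => nT.
pose box (s : seq E) := [set x | forall k e0, k < size s -> g x k = nth e0 s k].
have ext s : ~ small (box s) -> exists e, ~ small (box (rcons s e)).
  move=> ns; apply: contrapT => /forallNP H; apply: ns.
  have {}H e : small (box (rcons s e)) by apply: contrapT; exact: H.
  apply: (sW _ [set x | exists2 e, e \in enum E & box (rcons s e) x]).
    move=> x bx; exists (g x (size s)); first by rewrite mem_enum.
    move=> k e0; rewrite size_rcons ltnS leq_eqVlt nth_rcons => /orP[/eqP->|ks].
      by rewrite ltnn eqxx.
    by rewrite ks; exact: bx.
  elim: (enum E) => [|e r IH]; first by apply: sW s0 => x [].
  apply: sW (sU _ _ (H e) IH) => x [e']; rewrite inE => /orP[/eqP->|e'r] bx.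
    by left.
  by right; exists e'.
have /choice[f fP] : forall s, exists e, ~ small (box s) -> ~ small (box (rcons s e)).
  move=> s; have [sm|ns] := pselect (small (box s)).
    (* If [E] is empty, so is [X], and then the whole set is small. *)
    have [[e0 _]|nE] := pselect (exists e : E, True); first by exists e0.
    by case: nT; apply: sW s0 => x _; case: nE; exists (g x 0).
  by have [e He] := ext s ns; exists e.
pose st := fix st n := if n is m.+1 then rcons (st m) (f (st m)) else [::].
have sz n : size (st n) = n by elim: n => //= n IH; rewrite size_rcons IH.
have nst n : ~ small (box (st n)).
  elim: n => [|n IH] /=; last exact: fP.
  by move=> h; apply: nT; apply: sW h => x _ k e0.
pose p n := f (st n).
have nthst n k e0 : k < n -> nth e0 (st n) k = p k.
  elim: n => // n IH; rewrite ltnS leq_eqVlt /= nth_rcons sz => /orP[/eqP->|kn].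
    by rewrite ltnn eqxx.
  by rewrite kn IH.
have [M HM] := Hp p; apply: (nst M); apply: sW HM => x bx k kM.
by rewrite (bx k (p 0)) ?sz // nthst.
Qed.

Section Patterns.
Context (L : set lex2).
Notation Om := (set_type L).
Hypothesis left_dense : forall (f : Om) N,
  exists2 y : Om, (y < f)%O & pre N (val y) = pre N (val f).

Notation word N := {ffun 'I_N -> bool}.
Notation pr N y := (pre N (val y)).

(* In each cylinder [t] with [pW t] the set is a ray with end point [f t],
   final if [pe t] and initial otherwise; elsewhere it agrees with [ph]. *)
Record pattern := Pattern {
  pN : nat; pW : word pN -> bool; pe : word pN -> bool; ph : set Om }.

Definition fits (P : pattern) (u : set Om) (f : word (pN P) -> Om) :=
  [/\ forall y : Om, ~~ pW (pr (pN P) y) -> (u y <-> ph P y),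
      forall y : Om, pW (pr (pN P) y) ->
        (u y <-> pe (pr (pN P) y) = (f (pr (pN P) y) <= y)%O) &
      forall t : word (pN P), pW t -> pr (pN P) (f t) = t].

Section Fits.
Context (P : pattern).
Local Notation N := (pN P).
Implicit Types (u v c d : set Om) (f q : word N -> Om) (y z g : Om) (t : word N).

Lemma fits_jump u f g : fits u f -> pW (pr N g) -> jump u g <-> g = f (pr N g).
Proof.
move=> [_ Hu Hf] Wg; set t := pr N g in Wg *.
have Hu' y : pr N y = t -> (u y <-> pe t = (f t <= y)%O).
  by move=> e; have := Hu y; rewrite e; apply.
split=> [ju|gE].
  have [lt|lt|//] := ltgtP g (f t).
    have [y yg ey] := left_dense g N; have [z [yz zg nz]] := ju y yg.
    case: nz; have ez : pr N z = t.
      by rewrite /t -ey; exact: pr_conv yz (ltW zg) ey.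
    by rewrite !Hu' // !leNgt lt (lt_trans zg lt).
  have [z [yz zg nz]] := ju _ lt.
  case: nz; have ez : pr N z = t.
    by rewrite -[RHS](Hf t) //; apply: (@pr_conv _ _ _ _ g yz (ltW zg)); exact: Hf.
  by rewrite !Hu' // yz (ltW lt).
move=> y yg; have [y1 y1g ey1] := left_dense g N.
have mg : (Order.max y y1 < g)%O by rewrite gt_max yg.
exists (Order.max y y1); rewrite le_max lexx mg; split=> //.
have em : pr N (Order.max y y1) = t.
  have y1m : (y1 <= Order.max y y1)%O by rewrite le_max lexx orbT.
  by rewrite /t -ey1; exact: pr_conv y1m (ltW mg) ey1.
rewrite !Hu' // -gE lexx [(_ <= Order.max _ _)%O]leNgt mg /=.
by case: (pe t) => -[h1 h2]; [have := h2 erefl|have := h1 erefl].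
Qed.

Lemma fits_jump_out u f v q g : fits u f -> fits v q -> ~~ pW (pr N g) ->
  jump u g -> jump v g.
Proof.
move=> [Hu _ _] [Hv _ _] nW; apply: (@jump_local _ left_dense N) => z ez.
by rewrite Hu ?Hv // ez.
Qed.

(** Both sets are rays of the same direction in the cylinder of [y], so [y] lies between their end
    points, and cylinders are convex. *)
Lemma fits_between M d q d' q' y p : fits d q -> fits d' q' -> pW (pr N y) ->
  pre M (val (q (pr N y))) = pre M p -> pre M (val (q' (pr N y))) = pre M p ->
  d' y -> ~ d y -> pr M y = pre M p.
Proof.
move=> [_ Hd _] [_ Hd' _] Wy eq eq' /(Hd' _ Wy) e' nd.
have {}nd : pe (pr N y) != (q (pr N y) <= y)%O.
  by apply/eqP => e; apply: nd; apply/(Hd _ Wy).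
move: e' nd; case: (pe _) => /esym h1 => [|/negPf/negbT].
  by rewrite eq_sym eqb_id -ltNge => lt; rewrite -eq'; apply: pr_conv h1 (ltW lt) _;
    rewrite eq'.
move/negbT: h1; rewrite -ltNge => lt; rewrite eq_sym eqbF_neg negbK => le.
by rewrite -eq; apply: pr_conv le (ltW lt) _; rewrite eq.
Qed.

Lemma fits_side d q z y : fits d q -> pW (pr N z) -> pr N y = pr N z ->
  (~ d y -> d z -> pe (pr N z) = (y <= z)%O) /\
  (d y -> ~ d z -> pe (pr N z) <> (y <= z)%O).
Proof.
move=> [_ Hd _] Wz e.
have := Hd y; rewrite e => /(_ Wz) ->; rewrite (Hd z Wz).
set w := q _; case: (pe _).
  split; first by move=> /eqP; rewrite eq_sym eqb_id -ltNge => lt /esym le;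
    apply/esym; exact: le_trans (ltW lt) le.
  move=> /esym le /eqP; rewrite eq_sym eqb_id -ltNge => lt /esym le'.
  by have := le_trans le le'; rewrite leNgt lt.
split.
  move=> /eqP; rewrite eq_sym eqbF_neg negbK => le /esym/negbT; rewrite -ltNge => lt.
  by apply/esym/negbTE; rewrite -ltNge; exact: lt_le_trans le.
move=> /esym/negbT; rewrite -ltNge => lt /eqP; rewrite eq_sym eqbF_neg negbK => le.
by rewrite (ltW (lt_le_trans lt le)).
Qed.

(** Rays of one direction are nested according to their end points, and outside the cylinders in
    [pW] both sets agree with [ph]. *)
Lemma fits_sub c f d q : fits c f -> fits d q ->
  (forall t, pW t -> d (f t)) -> c `<=` d.
Proof.
move=> Hc Hd dF y cy; have [Wy|nWy] := boolP (pW (pr N y)); last first.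
  by case: Hc Hd => [H1 _ _] [H2 _ _]; apply/H2 => //; apply/H1.
case: Hc => _ H1 Hf; have [_ nd] := fits_side Hd Wy (Hf _ Wy).
apply: contrapT => ndy; apply: nd => //; first exact: dF.
by apply/H1.
Qed.

Lemma fits_sup c f d q : fits c f -> fits d q ->
  (forall t, pW t -> ~ d (f t)) -> d `<=` c.
Proof.
move=> Hc Hd dF y dy; have [Wy|nWy] := boolP (pW (pr N y)); last first.
  by case: Hc Hd => [H1 _ _] [H2 _ _]; apply/H1 => //; apply/H2.
case: Hc => _ H1 Hf; have [nd _] := fits_side Hd Wy (Hf _ Wy).
by apply/H1 => //; apply: nd => //; exact: dF.
Qed.

Lemma fitsU d q d' q' : fits d q -> fits d' q' -> exists q'', fits (d `|` d') q''.
Proof.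
move=> [H1 H2 H3] [H1' H2' H3'].
exists (fun t => if pe t then Order.min (q t) (q' t) else Order.max (q t) (q' t));
  split.
- by move=> y nW; rewrite /setU /= H1 ?H1' //; split=> [[]|]; tauto.
- move=> y Wy; rewrite /setU /= H2 ?H2' //; case: (pe _); rewrite ?ge_min ?ge_max.
    split; first by case=> <-; rewrite ?orbT.
    by move/esym/orP => [->|->]; [left|right].
  split; first by case=> <-; rewrite ?andbF.
  by move/esym/negbT; rewrite negb_and => /orP[/negbTE->|/negbTE->]; [left|right].
- move=> t Wt; case: (pe t); rewrite /Order.min /Order.max;
  by case: ifP; rewrite ?H3 ?H3'.
Qed.

Lemma fitsI d q d' q' : fits d q -> fits d' q' -> exists q'', fits (d `&` d') q''.
Proof.
move=> [H1 H2 H3] [H1' H2' H3'].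
exists (fun t => if pe t then Order.max (q t) (q' t) else Order.min (q t) (q' t));
  split.
- by move=> y nW; rewrite /setI /= H1 ?H1' //; split=> [[]|]; tauto.
- move=> y Wy; rewrite /setI /= H2 ?H2' //; case: (pe _); rewrite ?ge_min ?ge_max.
    split; first by case=> <- <-.
    by move/esym/andP => [-> ->].
  split; first by case=> <- <-.
  by move/esym/negbT; rewrite negb_or => /andP[/negbTE-> /negbTE->].
- move=> t Wt; case: (pe t); rewrite /Order.min /Order.max;
  by case: ifP; rewrite ?H3 ?H3'.
Qed.

End Fits.
End Patterns.

(** * Essential jumps *)

(** Equivalence of booleans is associative, so [z] cancels. *)
Lemma bool_agree (x y z b : bool) : (x = z <-> (y = z <-> b)) -> (x == y) = b.
Proof.
have tT : is_true true by []; have fF : ~ is_true false by [].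
have tf : ~ (true = false) by []; have ft : ~ (false = true) by [].
have [tt ff] : true = true /\ false = false by [].
by case: x; case: y; case: z; case: b => // H; tauto.
Qed.

Section Essential.
Context (L : set lex2).
Notation Om := (set_type L).
Notation pr N y := (pre N (val y)).
Notation word N := {ffun 'I_N -> bool}.
Hypothesis left_dense : forall (f : Om) N,
  exists2 y : Om, (y < f)%O & pr N y = pr N f.
Context (S : set (set Om)) (Q : set Om) (x0 : Om).
Hypothesis algS : ba_subalgebra S.
Hypothesis Sfin : S `<=` @fin_jumps L.
Hypothesis countQ : countable Q.
Implicit Types (u v w c d : set Om) (x y z g : Om).

Definition essential u x := jump u x /\ ~ Q x.
Definition ground := [set u | S u /\ forall x, jump u x -> Q x].
Definition minimal c := [/\ S c, exists x, essential c x &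
  forall v, S v -> (forall x, essential v x -> essential c x) -> (exists x, essential
    v x) ->
    forall x, essential c x -> essential v x].

Lemma groundP u : S u -> (forall x, ~ essential u x) -> ground u.
Proof.
move=> Su H; split=> // x jx; apply: contrapT => nQ; exact: (H x).
Qed.

Lemma ground_op u v w : (forall x y, (u x <-> u y) -> (v x <-> v y) -> (w x <-> w y)) ->
  ground u -> ground v -> S w -> ground w.
Proof.
move=> H [Su Hu] [Sv Hv] Sw; split=> // x.
by move=> /(jump_op left_dense H (Sfin Su) (Sfin Sv)) [/Hu|/Hv].
Qed.

Lemma alg_ground : ba_subalgebra ground.
Proof.
have H0 : ground set0.
  split; first exact: alg_set0 algS.
  move=> x jx; have [y yx _] := left_dense x 0.
  by have [z [_ _ []]] := jx y yx.
have HC u : ground u -> ground (~` u).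
  move=> Hu; have Sw := alg_setC algS Hu.1.
  by apply: (@ground_op u u) => // x y; rewrite /setC /=; tauto.
apply/ba_subalgebra_setP; split=> //.
- by rewrite -setC0; exact: HC.
- move=> u v Hu Hv; have Sw := alg_setU algS Hu.1 Hv.1.
  by apply: (@ground_op u v) => // x y; rewrite /setU /=; tauto.
- move=> u v Hu Hv; have Sw := alg_setI algS Hu.1 Hv.1.
  by apply: (@ground_op u v) => // x y; rewrite /setI /=; tauto.
Qed.

Lemma S_symd u v : S u -> S v -> S (symd u v).
Proof. by move=> Su Sv; apply: (alg_setU algS); exact: (alg_setD algS). Qed.

(** A set in the ground is determined by its finite set of jumps in [Q] and its value at [x0]: if
    two sets share both, their symmetric difference has no jumps and misses [x0]. *)
Lemma countable_ground : countable ground.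
Proof.
have /countable_injP[h hinj] := countable_finite_subset countQ.
pose b u := `[< u x0 >]; pose f u := (h [set x | jump u x]).*2 + b u.
have inD u : ground u -> [set x | jump u x] \in
    [set A | A `<=` Q /\ finite_set A].
  move=> [Su Hu]; rewrite inE; split=> //.
  have [A HA] := jumps_finite left_dense (Sfin Su).
  by rewrite (_ : mkset _ = [set` A]); [exact: finite_seq|
    apply/seteqP; split=> x /=; rewrite HA].
apply/countable_injP; exists f => u v /set_mem Hu /set_mem Hv.
rewrite /f => e.
have eb : b u = b v.
  by have := congr1 odd e; rewrite !oddD !odd_double !oddb.
have eh : [set x | jump u x] = [set x | jump v x].
  apply: hinj; rewrite ?inD //; move: e; rewrite eb => /addIn.
  by move/(congr1 half); rewrite !doubleK.
have Sw := S_symd Hu.1 Hv.1.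
have nj x : ~ jump (symd u v) x.
  rewrite (jump_symd left_dense _ (Sfin Hu.1) (Sfin Hv.1)).
  by have := congr1 (fun A : set Om => A x) eh; rewrite /= => ->; tauto.
have n0 : ~ symd u v x0.
  by rewrite symdP; move: eb; rewrite /b => e0; apply; split=> /asboolP;
    rewrite (e0, esym e0) => /asboolP.
have nw x : ~ symd u v x.
  have [le|le] := leP x x0.
    by rewrite (jump_free (Sfin Sw) le) // => a _ _; exact: nj.
  by rewrite -(jump_free (Sfin Sw) (ltW le)) // => a _ _; exact: nj.
apply/seteqP; split=> x ux; apply: contrapT => nx; apply: (nw x);
by rewrite symdP; tauto.
Qed.

Lemma capjump c v x : fin_jumps c -> fin_jumps v -> ~ jump v x ->
  jump (c `&` v) x <-> jump c x /\ v x.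
Proof.
move=> fc fv; have [y [yx Hc Hv]] := left_lim2 left_dense x fc fv.
have Hw z : (y <= z)%O -> (z < x)%O -> ((c `&` v) z <-> (c `&` v) y).
  by move=> yz zx; rewrite /setI /= Hc // Hv.
rewrite (jumpE yx Hw) (jumpE yx Hc) (jumpE yx Hv) /setI /=.
have := pselect (v x); have := pselect (c x).
have := pselect (v y); have := pselect (c y); tauto.
Qed.

(** The essential jumps of the intersection of [c] and [v] are those of [c] lying in [v]; if there
    is one, minimality gives all. *)
Lemma min_side c v x x' : minimal c -> ground v -> essential c x -> essential c x' ->
  v x -> v x'.
Proof.
move=> [Sc _ mc] [Sv Hv] [jx nQx] [jx' nQx'] vx.
have nj z : ~ Q z -> ~ jump v z by move=> nQ /Hv.
have E z : ~ Q z -> jump (c `&` v) z <-> jump c z /\ v z.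
  by move=> nQ; apply: capjump; [exact: Sfin|exact: Sfin|exact: nj].
have [|||//|jw _] := mc (c `&` v) _ _ _ x'.
- exact: (alg_setI algS).
- by move=> z [jz nQz]; split=> //; exact: ((E z nQz).1 jz).1.
- by exists x; split=> //; apply/E.
- by have [] := (E x' nQx').1 jw.
Qed.

Lemma essential_symd u v x : S u -> S v ->
  essential (symd u v) x <-> ~ (essential u x <-> essential v x).
Proof.
move=> Su Sv; rewrite /essential (jump_symd left_dense _ (Sfin Su) (Sfin Sv)).
have := pselect (Q x); have := pselect (jump u x); have := pselect (jump v x); tauto.
Qed.

(** Induction on the number of essential jumps: if [c] is not minimal, some [v] has a proper
    nonempty part of its essential jumps, the set [symd c v] has the others, and [c] is the
    symmetric difference of the two. *)
Lemma generated_minimal : S `<=` ba_generated (ground `|` minimal).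
Proof.
move=> c Sc; have algG := generated_alg (ground `|` minimal).
have [A HA] := jumps_finite left_dense (Sfin Sc).
have {HA} : forall x, essential c x -> x \in A by move=> x [/HA].
have shrink (B : seq Om) x : x \in B -> size [seq y <- B | y != x] < size B.
  move=> xB; rewrite size_filter ltn_neqAle count_size andbT -all_count.
  by apply/allPn; exists x; rewrite ?eqxx.
have [n] := ubnP (size A); elim: n => // n IH in A c Sc *; rewrite ltnS => sA HA.
have [ex|nex] := pselect (exists x, essential c x); last first.
  by apply: generated_incl; left; apply: groundP => // x ex; apply: nex; exists x.
have [mc|nmc] := pselect (minimal c); first by apply: generated_incl; right.
have [v [Sv vc [x vx] [y cy nvy]]] : exists v, [/\ S v,
    forall x, essential v x -> essential c x, exists x, essential v x &
    exists2 y, essential c y & ~ essential v y].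
  apply: contrapT => H; apply: nmc; split=> // v Sv vc vx y cy.
  by apply: contrapT => nvy; apply: H; exists v; split=> //; exists y.
have gv : ba_generated (ground `|` minimal) v.
  apply: (IH [seq z <- A | z != y]) => //.
    by apply: leq_trans sA; apply: shrink; exact: HA.
  move=> z vz; rewrite mem_filter HA ?andbT; last exact: vc.
  by apply/eqP => e; rewrite e in vz.
have gcv : ba_generated (ground `|` minimal) (symd c v).
  have Scv := S_symd Sc Sv.
  apply: (IH [seq z <- A | z != x]) => //.
    by apply: leq_trans sA; apply: shrink; apply: HA; exact: vc.
  move=> z; rewrite essential_symd // => cvz; rewrite mem_filter; apply/andP; split.
    apply/eqP => e; apply: cvz; rewrite e; split=> // _; exact: vc.
  apply: HA; apply: contrapT => ncz; apply: cvz; split=> // /vc //.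
rewrite -(symdK c v); apply: (alg_setU algG); exact: (alg_setD algG).
Qed.

Definition twosided (B : set Om) (p : lex2) := forall M,
  (exists g, [/\ B g, pr M g = pre M p & (val g < p)%O]) /\
  (exists g, [/\ B g, pr M g = pre M p & (p < val g)%O]).
Definition adherent (B : set Om) (p : lex2) :=
  forall M, exists2 g, B g & pr M g = pre M p.
Definition traces (P : pattern L) (t : word (pN P)) :=
  [set x | exists u f, [/\ S u, fits (P := P) u f & f t = x]].

Context (pat : nat -> pattern L) (F : nat -> set lex2).
Hypothesis pat_out : forall i x,
  ~~ pW (p := pat i) (pr (pN (pat i)) x) -> jump (ph (pat i)) x -> Q x.
Hypothesis pat_approx : forall i (t : word (pN (pat i))) x M, pW t -> traces t x ->
  exists u q, [/\ S u, fits (P := pat i) u q, pr M (q t) = pr M x &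
    forall t', pW t' -> Q (q t')].
Hypothesis F_closed : forall i p,
  (forall M, exists2 x, F i x & pre M x = pre M p) -> F i p.
Hypothesis F_Q : forall i x, F i (val x) -> ~ Q x.
Hypothesis F_twosided : forall i (t : word (pN (pat i))) p, pW t -> F i p ->
  adherent (traces t) p -> twosided (traces t) p.

Definition member i c (f : word (pN (pat i)) -> Om) := [/\ minimal c,
  fits (P := pat i) c f, forall x, essential c x <-> exists2 t, pW t & f t = x &
  forall t, pW t -> F i (val (f t))].

Hypothesis minimal_fits : forall c, minimal c -> exists i f, @member i c f.

Definition family i c x := essential c x /\ exists f, @member i c f.
(** The separators of the [i]-th family; sharing its pattern makes them comparable with its
    members. *)
Definition frame i : set (set Om) := [set d | [\/ d = set0, d = setT |
  ground d /\ exists q, fits (P := pat i) d q]].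

Lemma fits_ground i u q : S u -> fits (P := pat i) u q ->
  (forall t, pW t -> Q (q t)) -> ground u.
Proof.
move=> Su fu qQ; split=> // x jx.
have [Wx|nWx] := boolP (pW (p := pat i) (pr (pN (pat i)) x)).
  by rewrite ((fits_jump left_dense fu Wx).1 jx); exact: qQ.
apply: (pat_out nWx); apply: (jump_local left_dense _ jx (N := pN (pat i))) => z ez.
by case: fu => H _ _; apply: H; rewrite ez.
Qed.

(** Two-sidedness gives traces near [p] on each side. Each is replaced by one with end points in
    [Q], close enough to remain near [p] and on the same side. *)
Lemma approx_side i t p M : pW t -> F i p -> adherent (traces (P := pat i) t) p ->
  (exists d q, [/\ ground d, fits (P := pat i) d q, pr M (q t) = pre M p
    & (val (q t) < p)%O]) /\
  (exists d q, [/\ ground d, fits (P := pat i) d q, pr M (q t) = pre M p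
    & (p < val (q t))%O]).
Proof.
move=> Wt Fp ap; have [[g [Tg eg gp]] [g' [Tg' eg' pg']]] := F_twosided Wt Fp ap M.
split.
  have [K HK] := pre_sep (negbT (lt_eqF gp)).
  have [u [q [Su fu e qQ]]] := pat_approx (maxn M K) Wt Tg.
  have eM := preW (leq_maxl M K) e; have eK := preW (leq_maxr M K) e.
  exists u, q; split=> //; [exact: fits_ground fu qQ|by rewrite eM|].
  exact: pre_lt gp HK eK _.
have [K HK] := pre_sep (negbT (lt_eqF pg')).
have [u [q [Su fu e qQ]]] := pat_approx (maxn M K) Wt Tg'.
have eM := preW (leq_maxl M K) e; have eK := preW (leq_maxr M K) e.
exists u, q; split=> //; [exact: fits_ground fu qQ|by rewrite eM|].
exact: pre_lt pg' HK _ eK.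
Qed.

Definition limit i (p : word (pN (pat i)) -> lex2) := forall M, exists c f,
  @member i c f /\ forall t, pW t -> pr M (f t) = pre M (p t).

(** * Limits of the end points in a family *)

Section Limits.
Context (i : nat) (p : word (pN (pat i)) -> lex2).
Hypothesis limp : @limit i p.
Local Notation N := (pN (pat i)).
Implicit Types t : word N.

Definition near M d := forall t y, pW t -> pr M y = pre M (p t) -> d y.

Lemma nearW M M' d : M <= M' -> near M d -> near M' d.
Proof. by move=> MM' H t y Wt e; apply: H (Wt) _; exact: preW e. Qed.

Lemma limit_word t : pW t -> pre N (p t) = t.
Proof.
by move=> Wt; have [c [f [[_ [_ _ Hf'] _ _] <-]]] := limp N; first exact: Hf'.
Qed.

Lemma limit_F t : pW t -> F i (p t).
Proof.
move=> Wt; apply: F_closed => M; have [c [f [[_ _ _ Ff] e]]] := limp M.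
by exists (val (f t)); [exact: Ff|exact: e].
Qed.

Lemma limit_adherent t : pW t -> adherent (traces t) (p t).
Proof.
move=> Wt M; have [c [f [[[Sc _ _] Hc _ _] e]]] := limp M.
by exists (f t); [exists c, f|exact: e].
Qed.

Lemma limit_ex : exists t, pW t.
Proof.
by have [c [f [[[_ [x cx] _] _ /(_ x) [/(_ cx) [t Wt _] _] _] _]]] := limp 0; exists t.
Qed.

(** The finitely many jumps of [d] are in [Q] and so differ from the limit points, which lie in
    [F i]; hence [d] is constant near each [p t]. The constants agree because [d] contains all or
    none of the essential jumps of a member close to [p]. *)
Lemma limit_side d : ground d -> exists M,
  near M d \/ near M (~` d).
Proof.
move=> Sd; have [A HA] := jumps_finite left_dense (Sfin Sd.1).
have [M HM] : exists M, forall t, pW t -> forall a, a \in A -> pr M a <> pre M (p t).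
  apply: ex_bound_fin => [t M M' MM' H Wt a aA e|t].
    by apply: (H Wt a aA); exact: preW e.
  have [Wt|nW] := pselect (is_true (pW t)); last by exists 0.
  have [||M HM] := @ex_bound _ A (fun a M => pr M a <> pre M (p t)).
  - by move=> a M M' MM' H e; apply: H; exact: preW e.
  - move=> a aA; apply: pre_sep; apply/eqP => e.
    apply: (@F_Q i a); first by rewrite e; exact: limit_F.
    by apply: Sd.2; apply/HA.
  - by exists M => _.
have [c [f [[mc fc cf _] e]]] := limp M.
have cst t y : pW t -> pr M y = pre M (p t) -> (d y <-> d (f t)).
  move=> Wt ey; have ef := e t Wt.
  have [le|/ltW le] := leP y (f t); [|apply: iff_sym];
  apply: (jump_free (Sfin Sd.1) le) => a lta lea /HA aA;
  apply: (HM t Wt a aA).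
    by rewrite -ey; apply: pr_conv (ltW lta) lea _; rewrite ey.
  by rewrite -ef; apply: pr_conv (ltW lta) lea _; rewrite ef.
have [t1 Wt1] := limit_ex.
have ce t : pW t -> essential c (f t) by move=> Wt; apply/cf; exists t.
exists M; have [dt|ndt] := pselect (d (f t1)); [left|right] => t y Wt ey.
  by apply/(cst t y Wt ey); exact: min_side mc Sd (ce _ Wt1) (ce _ Wt) dt.
move=> /(cst t y Wt ey) dt; apply: ndt.
exact: min_side mc Sd (ce _ Wt) (ce _ Wt1) dt.
Qed.

Lemma limit_point M t : pW t -> exists y, pr M y = pre M (p t).
Proof. by move=> Wt; have [c [f [_ e]]] := limp M; exists (f t); exact: e. Qed.

(** In each cylinder, ground sets with end points on either side of [p t] enclose this limit, and by
    [limit_side] they do the same at all other limit points. The finitely many cylinders are then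
    combined by unions and intersections. *)
Lemma limit_approx M : exists d d', [/\ ground d /\ ground d',
  (exists q, fits (P := pat i) d q) /\ (exists q, fits (P := pat i) d' q), d `<=` d',
  exists M', near M' d' /\ near M' (~` d) &
  forall y, d' y -> ~ d y -> exists2 t, pW t & pr M y = pre M (p t)].
Proof.
have one t : pW t -> exists d d', [/\ ground d /\ ground d',
    (exists q, fits (P := pat i) d q) /\ (exists q, fits (P := pat i) d' q),
    exists M', near M' d' /\ near M' (~` d) &
    forall y, pr N y = t -> d' y -> ~ d y -> pr M y = pre M (p t)].
  move=> Wt; have [[d1 [q1 [Sd1 f1 e1 lt1]]] [d2 [q2 [Sd2 f2 e2 lt2]]]] :=
    approx_side M Wt (limit_F Wt) (limit_adherent Wt).
  have [K1 HK1] := pre_sep (negbT (lt_eqF lt1)).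
  have [K2 HK2] := pre_sep (negbT (lt_eqF lt2)).
  have [M1 n1] := limit_side Sd1; have [M2 n2] := limit_side Sd2.
  pose K := maxn (maxn (maxn K1 K2) N) (maxn M1 M2).
  (* A test point so close to [p t] that it lies between both end points and shows the value of [d1]
     and [d2] near the limit. *)
  have [y ey] := limit_point K Wt.
  have le M' : M' <= K -> pr M' y = pre M' (p t) by move=> h; exact: preW ey.
  have eN : pr N y = t by rewrite -(limit_word Wt); apply: le;
    rewrite /K !leq_max leqnn ?orbT.
  have ly1 : (q1 t <= y)%O.
    rewrite -le_val ltW //; apply: pre_lt lt1 HK1 _ _ => //.
    by apply: le; rewrite /K !leq_max leqnn ?orbT.
  have ly2 : (y < q2 t)%O.
    rewrite -lt_val; apply: pre_lt lt2 HK2 _ _ => //.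
    by apply: le; rewrite /K !leq_max leqnn ?orbT.
  have v1 : d1 y <-> pe t = true.
    by case: f1 => _ /(_ y) + _; rewrite eN => /(_ Wt) ->; rewrite ly1.
  have v2 : d2 y <-> pe t = false.
    by case: f2 => _ /(_ y) + _; rewrite eN => /(_ Wt) ->; rewrite leNgt ly2.
  have y1 : pr M1 y = pre M1 (p t) by apply: le; rewrite /K !leq_max leqnn ?orbT.
  have y2 : pr M2 y = pre M2 (p t) by apply: le; rewrite /K !leq_max leqnn ?orbT.
  have nM1 d : near M1 d -> near (maxn M1 M2) d by apply: nearW; rewrite leq_maxl.
  have nM2 d : near M2 d -> near (maxn M1 M2) d by apply: nearW; rewrite leq_maxr.
  (* The direction of the rays decides which of the two is the inner set. *)
  have [pt|npt] := boolP (pe t).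
    exists d2, d1; split.
    - by [].
    - by split; [exists q2|exists q1].
    - exists (maxn M1 M2); split.
        by apply: nM1; case: n1 => // /(_ t y Wt y1); case; apply/v1.
      by apply: nM2; case: n2 => // /(_ t y Wt y2) /v2; rewrite pt.
    - move=> z ez d1z nd2z.
      by apply: (fits_between f2 f1 _ _ _ d1z nd2z); rewrite ez.
  exists d1, d2; split.
  - by [].
  - by split; [exists q1|exists q2].
  - exists (maxn M1 M2); split.
      by apply: nM2; case: n2 => // /(_ t y Wt y2); case; apply/v2/negbTE.
    by apply: nM1; case: n1 => // /(_ t y Wt y1) /v1 pt; rewrite pt in npt.
  - move=> z ez d2z nd1z.
    by apply: (fits_between f1 f2 _ _ _ d2z nd1z); rewrite ez.
have [t0 Wt0] := limit_ex.
have all (s : seq (word N)) : exists d d', [/\ ground d /\ ground d',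
    (exists q, fits (P := pat i) d q) /\ (exists q, fits (P := pat i) d' q),
    exists M', near M' d' /\ near M' (~` d) &
    forall y, pr N y \in s -> pW (pr N y) -> d' y -> ~ d y ->
      pr M y = pre M (p (pr N y))].
  elim: s => [|t s [d [d' [[Sd Sd'] [[q fd] [q' fd']] [M' [nd' nd]] Hs]]]].
    by have [d [d' [? ? ? _]]] := one t0 Wt0; exists d, d'; split.
  have [Wt|nWt] := boolP (pW t); last first.
    exists d, d'; split=> //; [by split; [exists q|exists q']|by exists M'|].
    move=> y; rewrite inE => /orP[/eqP ->|]; last exact: Hs.
    by move=> h; rewrite h in nWt.
  have [e [e' [[Se Se'] [[r fe] [r' fe']] [M'' [ne' ne]] Ht]]] := one t Wt.
  exists (d `|` e), (d' `&` e'); split.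
  - by split; [exact: alg_setU alg_ground _ _ Sd Se|exact:
    alg_setI alg_ground _ _ Sd' Se'].
  - by split; [exact: fitsU fd fe|exact: fitsI fd' fe'].
  - exists (maxn M' M''); split=> t' y Wt' ey.
      split; [apply: nd' Wt' _|apply: ne' Wt' _];
      by apply: preW ey; rewrite ?leq_maxl ?leq_maxr.
    case; [apply: nd Wt' _|apply: ne Wt' _];
    by apply: preW ey; rewrite ?leq_maxl ?leq_maxr.
  - move=> y; rewrite inE => ys Wy [d'y e'y] /not_orP[ndy ney].
    by case/orP: ys => [/eqP ys|ys]; [rewrite ys; exact: Ht|exact: Hs].
have [d [d' [[Sd Sd'] [[q fd] [q' fd']] [M' [nd' nd]] Hs]]] := all (enum {: word N}).
(* The intersection forces the inclusion and changes nothing near the limit. *)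
exists (d `&` d'), d'; split.
- by split=> //; exact: alg_setI alg_ground _ _ Sd Sd'.
- by split; [exact: fitsI fd fd'|exists q'].
- by move=> y [].
- by exists M'; split=> // t y Wt ey [dy _]; exact: nd Wt ey dy.
- move=> y d'y ndd; have ndy : ~ d y by move=> dy; exact: ndd.
  have [Wy|nWy] := boolP (pW (p := pat i) (pr N y)).
    by exists (pr N y) => //; apply: Hs => //; rewrite mem_enum.
  by case: fd fd' => [h _ _] [h' _ _]; case: ndy; apply/h => //; apply/h'.
Qed.

End Limits.

Lemma own_limit i c f : @member i c f -> @limit i (fun t => val (f t)).
Proof. by move=> H M; exists c, f. Qed.

Lemma frame_ground i : frame i `<=` ground.
Proof.
move=> d [->|->|[]//]; [exact: alg_set0 alg_ground|exact: alg_setT alg_ground].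
Qed.

Lemma frame_setU i d d' : frame i d -> frame i d' -> frame i (d `|` d').
Proof.
move=> [->|->|[Sd [q fd]]] [->|->|[Sd' [q' fd']]];
  rewrite ?set0U ?setU0 ?setTU ?setUT; try by [constructor 1|constructor 2].
- by constructor 3; split=> //; exists q'.
- by constructor 3; split=> //; exists q.
- by constructor 3; split; [exact: alg_setU alg_ground _ _ Sd Sd'|exact: fitsU fd fd'].
Qed.

Lemma frame_setI i d d' : frame i d -> frame i d' -> frame i (d `&` d').
Proof.
move=> [->|->|[Sd [q fd]]] [->|->|[Sd' [q' fd']]];
  rewrite ?set0I ?setI0 ?setTI ?setIT; try by [constructor 1|constructor 2].
- by constructor 3; split=> //; exists q'.
- by constructor 3; split=> //; exists q.
- by constructor 3; split; [exact: alg_setI alg_ground _ _ Sd Sd'|exact: fitsI fd fd'].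
Qed.

Lemma member_side i c f d : @member i c f -> ground d ->
  (forall t, pW t -> d (f t)) \/ (forall t, pW t -> ~ d (f t)).
Proof.
move=> [mc _ cf _] Sd; have ce t : pW t -> essential c (f t) by move=> Wt; apply/cf;
  exists t.
have [H|H] := pselect (exists2 t, pW t & d (f t)); [left|right] => t Wt.
  by have [t1 Wt1 dt1] := H; exact: min_side mc Sd (ce _ Wt1) (ce _ Wt) dt1.
by move=> dt; apply: H; exists t.
Qed.

Lemma member_comparable i c f d q :
  @member i c f -> ground d -> fits (P := pat i) d q ->
  ((forall t, pW t -> d (f t)) /\ c `<=` d) \/
  ((forall t, pW t -> ~ d (f t)) /\ d `<=` c).
Proof.
move=> H Sd fd; have fc : fits (P := pat i) c f by case: H.
have [h|h] := member_side H Sd; [left|right]; split=> //.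
  exact: fits_sub fc fd h.
exact: fits_sup fc fd h.
Qed.

Lemma family_frame i c x d : family i c x -> frame i d ->
  (d x /\ c `<=` d) \/ (~ d x /\ d `<=` c).
Proof.
move=> [cx [f H]] [->|->|[Sd [q fd]]].
- by right; split=> // y [].
- by left.
have [t Wt <-] : exists2 t, pW t & f t = x by case: H => _ _ /(_ x) [+ _] _; apply.
by have [[h hc]|[h hc]] := member_comparable H Sd fd; [left|right]; split=> //;
  exact: h.
Qed.

(** Members with the same end points are equal. Otherwise a ground set of the same pattern ends
    strictly between two corresponding end points; it is comparable with both members and contains
    the end points of exactly one of them. *)
Lemma family_chain i c x c' x' : family i c x -> family i c' x' ->
  c `<=` c' \/ c' `<=` c.
Proof.
move=> [_ [f H]] [_ [f' H']].
have [[mc fc _ Ff] [mc' fc' _ Ff']] := (H, H').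
have [eq|] := pselect (forall t, pW t -> f t = f' t).
  left=> y cy; have [Wy|nWy] := boolP (pW (p := pat i) (pr (pN (pat i)) y)); last first.
    by case: fc fc' => [h _ _] [h' _ _]; apply/h' => //; apply/h.
  case: fc fc' => [_ h _] [_ h' _]; apply/h' => //.
  by rewrite -eq //; apply/h.
move=> /existsNP[t /not_implyP[Wt /eqP ne]].
have Tt u r : S u -> fits (P := pat i) u r -> adherent (traces (P := pat i) t) (val
  (r t)).
  by move=> Su fu M; exists (r t) => //; exists u, r.
have bet r r' c1 c1' : @member i c1 r -> @member i c1' r' -> (r t < r' t)%O ->
    exists d q, [/\ ground d, fits (P := pat i) d q, (r t < q t)%O & (q t < r' t)%O].
  move=> Hg Hg' lt; have [[[Sc1 _ _] fc1 _ Fg] [_ _ _ Fg']] := (Hg, Hg').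
  have lt' : (val (r t) < val (r' t))%O by rewrite lt_val.
  have [K HK] := pre_sep (negbT (lt_eqF lt')).
  have [_ [d [q [Sd fd e ltq]]]] := approx_side K Wt (Fg t Wt) (Tt _ _ Sc1 fc1).
  exists d, q; split=> //.
  by rewrite -lt_val; exact: pre_lt lt' HK e erefl.
have [d [q [Sd fd sep]]] : exists d q, [/\ ground d, fits (P := pat i) d q &
    (f t < q t < f' t)%O || (f' t < q t < f t)%O].
  have [lt|lt|e] := ltgtP (f t) (f' t); last by rewrite e eqxx in ne.
    have [d [q [? ? a b]]] := bet _ _ _ _ H H' lt.
    by exists d, q; split=> //; rewrite a b.
  have [d [q [? ? a b]]] := bet _ _ _ _ H' H lt.
  by exists d, q; split=> //; rewrite a b orbT.
have de z : pr (pN (pat i)) z = t -> (d z <-> pe t = (q t <= z)%O).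
  by case: fd => _ /(_ z) + _ ez; rewrite ez; apply.
have ef : d (f t) <-> ~ d (f' t).
  rewrite !de; [|by case: fc' => _ _; apply|by case: fc => _ _; apply].
  move: sep => /orP[/andP[a b]|/andP[a b]];
    rewrite (ltW b) [(q t <= _)%O]leNgt a /=; by case: (pe t).
have [[h hc]|[h hc]] := member_comparable H Sd fd;
  have [[h' hc']|[h' hc']] := member_comparable H' Sd fd.
- by have := ef.1 (h t Wt) (h' t Wt).
- by left; exact: subset_trans hc'.
- by right; exact: subset_trans hc.
- by case: (h t Wt); apply/ef; exact: h'.
Qed.

(** One listed interval, clipped to lie between [a] and [b], is inserted as a single step; the
    remaining ones cover the cut points on both sides of it. *)
Lemma steps_cover i w (s : seq (set Om * set Om)) a b :
  (forall p, p \in s -> [/\ frame i p.1, frame i p.2, p.1 `<=` p.2 &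
     p.2 `\` p.1 `<=` w \/ p.2 `\` p.1 `<=` ~` w]) ->
  frame i a -> frame i b -> a `<=` b ->
  (forall x, hits family i x -> (b `\` a) x -> exists2 p, p \in s & (p.2 `\` p.1) x) ->
  steps (frame i) (good family i w) a b.
Proof.
elim: s a b => [|[d d'] s IH] a b Hs Ra Rb ab cov.
  apply: (@steps_cons _ _ _ _ b) => //; last exact: steps_refl.
  by constructor 1 => x mx bx; have [] := cov x mx bx.
have [/= Rd Rd' dd' gd] := Hs (d, d') (mem_head _ _).
have Hs' p : p \in s -> [/\ frame i p.1, frame i p.2, p.1 `<=` p.2 &
    p.2 `\` p.1 `<=` w \/ p.2 `\` p.1 `<=` ~` w].
  by move=> ps; apply: Hs; rewrite inE ps orbT.
pose a' := (d `|` a) `&` b; pose b' := (d' `|` a) `&` b.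
have Ra' : frame i a' by apply: frame_setI => //; exact: frame_setU.
have Rb' : frame i b' by apply: frame_setI => //; exact: frame_setU.
have aa' : a `<=` a' by move=> x ax; split; [right|exact: ab].
have b'b : b' `<=` b by move=> x [].
have a'b' : a' `<=` b' by move=> x [[/dd'|] ? ?]; split; [left| |right|].
have a'b : a' `<=` b by move=> x [].
apply: (@steps_trans _ _ _ _ a').
  apply: IH => // x mx [[[dx|ax] bx] nax] //.
  have [p] := cov x mx (conj bx nax); rewrite inE => /orP[/eqP->/= [_]|] //.
  by exists p.
apply: (@steps_cons _ _ _ _ b') => //.
  have sub : b' `\` a' `<=` d' `\` d.
    move=> x [[[d'x|ax] bx] na'x].
      by split=> // dx; apply: na'x; split=> //; left.
    by case: na'x; split=> //; right.
  by case: gd => gd; [constructor 2|constructor 3]; exact: subset_trans gd.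
apply: IH => // x mx [bx nb'x].
have nax : ~ a x by move=> ax; apply: nb'x; split=> //; right.
have [p] := cov x mx (conj bx nax); rewrite inE => /orP[/eqP->/= [d'x _]|].
  by case: nb'x; split=> //; left.
by exists p.
Qed.

(** Near each limit of end points a single frame interval decides [w] and catches all cut points of
    the members close to it; by compactness finitely many intervals suffice. *)
Lemma frame_steps i w : ground w -> steps (frame i) (good family i w) set0 setT.
Proof.
move=> Sw; pose N := pN (pat i).
pose ok (s : seq (set Om * set Om)) := forall p, p \in s ->
  [/\ frame i p.1, frame i p.2, p.1 `<=` p.2 &
     p.2 `\` p.1 `<=` w \/ p.2 `\` p.1 `<=` ~` w].
pose small (B : set (word N -> Om)) := exists2 s, ok s &
  forall c f, @member i c f -> B f ->
    exists2 p, p \in s & forall t, pW t -> (p.2 `\` p.1) (f t).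
have : small setT.
  (* A tuple of end points is read as one sequence, whose [k]-th letter collects the [k]-th bits of
     all entries. *)
  pose E : finType := {ffun word N -> bool}.
  pose g (f : word N -> Om) k : E := [ffun t => (val (f t) : nat -> bool) k].
  apply: (@konig E _ g).
  - by exists [::].
  - move=> A B [s oks Hs] [s' oks' Hs']; exists (s ++ s').
      by move=> p; rewrite mem_cat => /orP[/oks|/oks'].
    move=> c f Hc [/(Hs c f Hc)|/(Hs' c f Hc)] [p ps pt]; exists p => //;
    by rewrite mem_cat ps ?orbT.
  - by move=> A B AB [s oks Hs]; exists s => // c f Hc /AB; exact: Hs Hc.
  move=> p0; pose p (t : word N) : lex2 := fun k => p0 k t.
  have box M f : (forall k, k < M -> g f k = p0 k) ->
      forall t, pr M (f t) = pre M (p t).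
    by move=> H t; apply/preP => k /H/ffunP/(_ t); rewrite ffunE.
  (* A branch that is not a limit has a neighbourhood without members. *)
  have [limp|nlp] := pselect (@limit i p); last first.
    move: nlp => /existsNP[M /forallNP nM]; exists M, [::] => // c f Hc bf.
    case: (nM c); exists f; split=> // t _; exact: box.
  have [M0 sw] := limit_side limp Sw.
  have [d [d' [[Sd Sd'] [fd fd'] dd' [M' [nd' nd]] bt]]] := limit_approx limp M0.
  exists M', [:: (d, d')].
    move=> q; rewrite inE => /eqP->; split=> //=; [by constructor 3|by constructor 3|].
    case: sw => sw; [left|right] => y [d'y ndy];
    by have [t Wt e] := bt y d'y ndy; exact: sw Wt e.
  move=> c f Hc /box bf; exists (d, d'); rewrite ?inE ?eqxx // => t Wt; split.
    exact: nd' Wt (bf t).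
  exact: nd Wt (bf t).
move=> [s oks Hs]; apply: (steps_cover oks).
- by constructor 1.
- by constructor 2.
- by [].
move=> x [c [cx [f Hc]]] _; have [p ps pt] := Hs c f Hc I.
exists p => //; have [t Wt <-] : exists2 t, pW t & f t = x.
  by case: Hc => _ _ /(_ x) [+ _] _; apply.
exact: pt.
Qed.

(** * Moving a minimal element to another family that accumulates at its jumps *)

Section Transfer.
Context (i j : nat) (c : set Om) (f : word (pN (pat i)) -> Om) (x : Om).
Hypothesis Hc : @member i c f.
Hypothesis cx : essential c x.
Hypothesis near_j : forall w, ground w -> w x -> exists2 y, hits family j y & w y.
Local Notation N := (pN (pat i)).
Local Notation N' := (pN (pat j)).

Let lf := own_limit Hc.
Let mc : minimal c. Proof. by case: Hc. Qed.
Let cf y : essential c y <-> exists2 t, pW t & f t = y. Proof. by case: Hc. Qed.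
Let essf t : pW t -> essential c (f t). Proof. by move=> Wt; apply/cf; exists t. Qed.

(** A ground neighbourhood of the end points of [c] contains [x], hence a cut point of family [j],
    and then by [min_side] all end points of that member. *)
Lemma transfer_near M : exists c' f', @member j c' f' /\
  forall t', pW t' -> exists2 t, pW t & pr M (f' t') = pr M (f t).
Proof.
have [d [d' [[Sd Sd'] _ dd' [M' [nd' nd]] bt]]] := limit_approx lf M.
have [t0 Wt0 xE] := (cf x).1 cx.
have [y [c' [c'y [f' Hc']]] [d'y ndy]] : exists2 y, hits family j y & (d' `\` d) y.
  apply: near_j; first exact: alg_setD alg_ground _ _ Sd' Sd.
  by rewrite -xE; split; [exact: nd' Wt0 _|exact: nd Wt0 _].
exists c', f'; split=> // t' Wt'.
have [mc' _ cf' _] := Hc'.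
have [] : (d' `\` d) (f' t').
  apply: (min_side mc' (alg_setD alg_ground Sd' Sd) c'y) => //.
  by apply/cf'; exists t'.
exact: bt.
Qed.

(** There are finitely many correspondences of words; if each failed at some precision, all would
    fail at the largest of these. *)
Lemma transfer_choice : exists s : {ffun word N' -> word N}, forall M, exists c' f',
  @member j c' f' /\ forall t', pW t' -> pW (s t') /\ pr M (f' t') = pr M (f (s t')).
Proof.
apply: contrapT => /forallNP H.
pose bad (s : {ffun word N' -> word N}) M := ~ exists c' f',
  @member j c' f' /\ forall t', pW t' -> pW (s t') /\ pr M (f' t') = pr M (f (s t')).
have [|s|M HM] := @ex_bound_fin _ bad.
- move=> s M M' MM' nb [c' [f' [Hc' e]]]; apply: nb; exists c', f'; split=> // t' Wt'.
  by have [? /(preW MM')] := e t' Wt'.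
- by have /existsNP[M HM] := H s; exists M.
have [c' [f' [Hc' e]]] := transfer_near M.
have /choice[s0 Hs0] : forall t', exists t, pW t' -> pW t /\ pr M (f' t') = pr M (f t).
  move=> t'; have [Wt'|nW] := pselect (is_true (pW t')).
    by have [t Wt et] := e t' Wt'; exists t.
  by exists [ffun=> false].
apply: (HM [ffun t' => s0 t']); exists c', f'; split=> // t' Wt'.
by rewrite ffunE; exact: Hs0.
Qed.

(** The essential jumps of [c] form a limit [p] of family [j]. Either a nearby member has exactly
    these end points, or [c] or its complement can be inserted between ground sets of pattern [j] to
    produce such a member. *)
Lemma transfer : exists c' f', @member j c' f'
  /\ forall y, essential c' y <-> essential c y.
Proof.
have [s Hs] := transfer_choice.
pose p (t' : word N') := f (s t').
have Ws t' : pW t' -> pW (s t').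
  by move=> Wt'; have [c' [f' [_ /(_ t' Wt') []]]] := Hs 0.
have limp : @limit j (fun t' => val (p t')).
  move=> M; have [c' [f' [Hc' e]]] := Hs M; exists c', f'; split=> // t' Wt'.
  by have [] := e t' Wt'.
have [t0' Wt0'] := limit_ex limp.
have pword t' : pW t' -> pr N' (p t') = t' by exact: limit_word limp t'.
(* A ground neighbourhood of [p] contains some essential jump of [c], hence all of them. *)
have range t : pW t -> exists2 t', pW t' & f t = p t'.
  move=> Wt; apply: contrapT => H.
  have [|t'|M HM] := @ex_bound_fin (word N')
      (fun t' M => pW t' -> pr M (f t) <> pr M (p t')).
  - by move=> t' M M' MM' h Wt' e; apply: (h Wt'); exact: preW e.
  - have [Wt'|nW] := pselect (is_true (pW t')); last by exists 0.
    have [|M HM] := @pre_sep (val (f t)) (val (p t')).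
      by apply/eqP => /val_inj e; apply: H; exists t'.
    by exists M.
  have [d [d' [[Sd Sd'] _ dd' [M' [nd' nd]] bt]]] := limit_approx limp M.
  have [] : (d' `\` d) (f t); last first.
    by move=> d't ndt; have [t' Wt' e] := bt _ d't ndt; exact: (HM t' Wt' e).
  apply: (min_side mc (alg_setD alg_ground Sd' Sd) (essf (Ws t0' Wt0')) (essf Wt)).
  by split; [exact: nd' Wt0' _|exact: nd Wt0' _].
have essp y : essential c y <-> exists2 t', pW t' & p t' = y.
  rewrite cf; split=> [[t /range[t' Wt' ->] <-]|[t' Wt' <-]]; first by exists t'.
  by exists (s t') => //; exact: Ws.
apply: contrapT => nex.
pose M0 := maxn N N'.
have [d2 [d2' [[Sd2 Sd2'] [[q2 fd2] [q2' fd2']] dd2 [M1 [nd2' nd2]] bt2]]] :=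
  limit_approx limp M0.
have [c' [f' [Hc' ef']]] := Hs (maxn M1 M0).
have [mc' fc' cf' Ff'] := Hc'.
have essf' t' : pW t' -> essential c' (f' t') by move=> Wt'; apply/cf'; exists t'.
have word' t' : pW t' -> pr N' (f' t') = t' by case: fc' => _ _; apply.
have nearf' t' : pW t' -> pr M0 (f' t') = pr M0 (p t').
  by move=> Wt'; have [_ /preW] := ef' t' Wt'; apply; rewrite leq_maxr.
have [t1 [Wt1 ne1]] : exists t', pW t' /\ f' t' <> p t'.
  apply: contrapT => H; apply: nex; exists c', f'; split=> // y.
  rewrite cf' essp; split=> -[t' Wt' <-]; exists t' => //; [apply: esym|];
  by apply: contrapT => h; apply: H; exists t'.
have [|[t' t]|M2 HM2] := @ex_bound_fin (word N' * word N)%type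
    (fun tt M => pW tt.1 -> pW tt.2 -> f' tt.1 <> f tt.2 ->
       pr M (f' tt.1) <> pr M (f tt.2)).
- by move=> tt M M' MM' h W1 W2 ne e; apply: (h W1 W2 ne); exact: preW e.
- have [e|ne] := pselect (f' t' = f t); first by exists 0.
  have [|M HM] := @pre_sep (val (f' t')) (val (f t)).
    by apply/eqP => /val_inj.
  by exists M.
have {}HM2 t' t : pW t' -> pW t -> f' t' <> f t -> pr M2 (f' t') <> pr M2 (f t).
  exact: (HM2 (t', t)).
have [d [d' [[Sd Sd'] [[q fd] [q' fd']] dd' [M3 [nd' nd]] bt]]] := limit_approx lf M2.
have pin t' : pW t' -> (d' `\` d) (p t').
  by move=> Wt'; split; [exact: nd' (Ws t' Wt') _|exact: nd (Ws t' Wt') _].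
(* One end point of [c'] in this neighbourhood would bring in all, among them [f' t1]; by the choice
   of [M2] it would then equal an end point of [c], namely [p t1]. *)
have out t' : pW t' -> ~ (d' `\` d) (f' t').
  move=> Wt' h.
  have [d'1 nd1] := min_side mc' (alg_setD alg_ground Sd' Sd) (essf' _ Wt') (essf' _
    Wt1) h.
  have [t Wt e] := bt _ d'1 nd1; apply: (HM2 _ _ Wt1 Wt _ e).
  have [t2 Wt2 ->] := range t Wt => e1; apply: ne1; rewrite e1.
  by congr p; rewrite -(word' t1) // e1 pword.
have ne t' : pW t' -> f' t' <> p t'.
  by move=> Wt' e; apply: (out t' Wt'); rewrite e; exact: pin.
have ne' t' t'' : pW t' -> pW t'' -> f' t' <> p t''.
  move=> Wt' Wt'' e; apply: (ne t' Wt'); rewrite e; congr p.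
  by rewrite -(word' t') // e pword.
have [_ fc _ _] := Hc.
have dc : d `<=` c by apply: (fits_sup fc fd) => t Wt; exact: nd Wt _.
have cd' : c `<=` d' by apply: (fits_sub fc fd') => t Wt; exact: nd' Wt _.
have cE t' : pW t' -> (c (f' t') <-> d (f' t')).
  move=> Wt'; split=> [cy|/dc//]; apply: contrapT => ndy.
  by apply: (out t' Wt'); split=> //; exact: cd'.
have [e2 [e2' [[Se2 Se2'] [[r2 fe2] [r2' fe2']] ee2 [M4 [ne2' ne2]] be2]]] :=
  limit_approx limp M2.
have oute t' : pW t' -> ~ (e2' `\` e2) (f' t').
  move=> Wt' [h1 h2]; have [t'' Wt'' e] := be2 _ h1 h2.
  by apply: (HM2 _ _ Wt' (Ws _ Wt'') _ e); exact: ne'.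
have b2E t' : pW t' -> (e2 (f' t') <-> pe t' = (p t' <= f' t')%O).
  move=> Wt'; have wt' : pr N' (p t') = pr N' (f' t') by rewrite pword ?word'.
  have Wf : pW (p := pat j) (pr N' (f' t')) by rewrite word'.
  have [h1 _] := fits_side fe2 Wf wt'; have [_ h2] := fits_side fe2' Wf wt'.
  rewrite word' // in h1 h2; split=> [|e].
    by apply: h1; exact: ne2 Wt' _.
  apply: contrapT => ne2f; apply: h2 e; first exact: ne2' Wt' _.
  by move=> h; apply: (oute t' Wt').
have b1E t' : pW t' -> (c (f' t') <-> pe (s t') = (p t' <= f' t')%O).
  move=> Wt'; have ew : pr N (f' t') = s t'.
    have := preW (leq_maxl N N') (nearf' t' Wt'); rewrite /p => ->.
    by case: fc => _ _; apply; exact: Ws.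
  by case: fc => _ /(_ (f' t')) + _; rewrite ew; apply; exact: Ws.
(* On the end points of [c'], [c] agrees with the ground set [d], and each of [d] and [e2] contains
   all or none of them. Hence the directions in the two patterns agree at all words or are opposite
   at all words. *)
have [b b1] : exists b : bool, forall t', pW t' -> (c (f' t') <-> (e2 (f' t') <-> b)).
  have tT : is_true true by []; have fF : ~ is_true false by [].
  have us := member_side Hc' Sd; have ue := member_side Hc' Se2.
  case: us => us; case: ue => ue; [exists true|exists false|exists false|exists true];
    by move=> t' Wt'; rewrite cE //; have := us t' Wt'; have := ue t' Wt'; tauto.
have peE t' : pW t' -> (pe (s t') == pe t') = b.
  move=> Wt'; have := b1 t' Wt'; rewrite b1E // b2E //.
  exact: bool_agree.
pose cc := if b then c else ~` c.
have Scc : S cc by rewrite /cc; case: b {b1 peE cc};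
  [case: mc|apply: alg_setC algS _ _; case: mc].
have ccE t' y : pW t' -> pr M0 y = pr M0 (p t') -> (cc y <-> pe t' = (p t' <= y)%O).
  move=> Wt' ey; have ew : pr N y = s t'.
    have := preW (leq_maxl N N') ey; rewrite /p => ->.
    by case: fc => _ _; apply; exact: Ws.
  have cy : c y <-> pe (s t') = (p t' <= y)%O.
    by case: fc => _ /(_ y) + _; rewrite ew; apply; exact: Ws.
  rewrite /cc; have := peE t' Wt'; case: b {b1 peE cc Scc} => pb.
    by rewrite cy (eqP pb).
  rewrite /setC /= cy; move: pb.
  by case: (pe (s t')); case: (pe t'); case: (_ <= _)%O => //= _; split=> // h;
    try case: (h erefl).
(* Near [p] the set [cc] has the directions of pattern [j]; away from [p] the two ground sets supply
   the rest of the pattern. *)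
pose c2 := d2 `|` (cc `&` (d2' `\` d2)).
have Sc2 : S c2.
  apply: alg_setU algS _ _ Sd2.1 _; apply: alg_setI algS _ _ Scc _.
  exact: alg_setD algS _ _ Sd2'.1 Sd2.1.
have fc2 : fits (P := pat j) c2 p.
  split=> // y; last first.
    move=> Wy; set t' := pr N' y in Wy *.
    have wt' : pr N' (p t') = pr N' y by rewrite pword.
    have [h1 _] := fits_side fd2 Wy wt'; have [_ h2] := fits_side fd2' Wy wt'.
    have nd2p : ~ d2 (p t') by exact: nd2 Wy _.
    have d2'p : d2' (p t') by exact: nd2' Wy _.
    have [dy|ndy] := pselect (d2 y).
      by split=> [_|_]; [exact: h1|left].
    have [d'y|nd'y] := pselect (d2' y); last first.
      split=> [[//|[_ []//]]|e].
      by case: (h2 d2'p nd'y).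
    have [t'' Wt'' e] := bt2 y d'y ndy.
    have tt : t' = t''.
      by rewrite /t' (preW (leq_maxr N N') e) pword.
    rewrite -tt in e; rewrite -(ccE t' y Wy e).
    by split=> [[//|[]//]|ccy]; right; split.
  move=> nWy; case: fd2 fd2' => [h1 _ _] [h2 _ _].
  rewrite -(h1 y nWy); split=> [[//|[_ [/h2 -/(_ nWy) hy ndy]]]|]; last by left.
  by apply/h1.
have ess2 y : essential c2 y <-> essential c y.
  rewrite essp; split=> [[jy nQy]|[t' Wt' <-]].
    have [Wy|nWy] := boolP (pW (p := pat j) (pr N' y)).
      by exists (pr N' y) => //; apply/esym/(fits_jump left_dense fc2 Wy).
    have : essential c' y.
      by split=> //; exact: (fits_jump_out left_dense fc2 fc' nWy jy).
    by move=> /cf' [t' Wt' e]; rewrite -e word' ?Wt' in nWy.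
  split; last by have [] := (essp (p t')).2 (ex_intro2 _ _ t' Wt' erefl).
  by apply/(fits_jump left_dense fc2); rewrite pword.
apply: nex; exists c2, p; split; last exact: ess2.
split=> //.
- have [Sc [z cz] mcz] := mc; split=> //; first by exists z; apply/ess2.
  move=> v Sv vc vx y /ess2 cy; apply: (mcz v Sv) => // z' /vc /ess2 //.
- by move=> y; rewrite ess2 essp.
- by move=> t' Wt'; exact: (limit_F limp Wt').
Qed.

End Transfer.

Theorem essential_chain : exists C, [/\ is_chain C, C `<=` S & S `<=` ba_generated C].
Proof.
apply: (@chain_from_families _ S ground frame family) => //.
- exact: alg_ground.
- by move=> u [].
- exact: countable_ground.
- exact: frame_ground.
- exact: frame_setU.
- exact: frame_setI.
- by move=> i; constructor 1.
- by move=> i c x [_ [f [[]]]].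
- exact: family_chain.
- exact: family_frame.
- exact: frame_steps.
have algG := generated_alg (ground `|` separated_members ground family).
apply: subset_trans generated_minimal _; apply: generated_sub => // c [Sc|mc].
  by apply: generated_incl; left.
have [i [f Hc]] := minimal_fits mc.
have [x cx] : exists x, essential c x by case: mc.
pose near_j j := `[< forall w, ground w -> w x -> exists2 y, hits family j y & w y >].
have exj : exists j, near_j j.
  by exists i; apply/asboolP => w _ wx; exists x => //; exists c; split=> //; exists f.
have [j /asboolP nj minj] := ex_minnP exj.
have [c' [f' [Hc' e]]] := transfer Hc cx nj.
have gc' : ba_generated (ground `|` separated_members ground family) c'.
  apply: generated_incl; right; exists j, x; split.
    by split; [apply/e|exists f'].
  (* As [j] is least, each earlier family misses some ground neighbourhood of [x]; their
     intersection separates the new member. *)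
  have far k : k < j -> exists w, [/\ ground w, w x & miss family k w].
    move=> kj; apply: contrapT => H.
    suff /minj : near_j k by rewrite leqNgt kj.
    apply/asboolP => w Sw wx; apply: contrapT => H'; apply: H.
    by exists w; split=> // y hy wy; apply: H'; exists y.
  elim: j far {nj minj f' Hc'} => [|k IH] far.
    by exists setT; split=> //; exact: alg_setT alg_ground.
  have [|w [Sw wx mw]] := IH; first by move=> l lk; apply: far; exact: leqW.
  have [w' [Sw' w'x mw']] := far k (leqnn _).
  exists (w `&` w'); split=> //; first exact: alg_setI alg_ground _ _ Sw Sw'.
  move=> l; rewrite ltnS leq_eqVlt => /orP[/eqP->|/mw ml].
    by apply: missW mw' => y [].
  by apply: missW ml => y [].
have Sc : S c by case: mc.
have Sc' : S c' by case: Hc' => -[].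
rewrite -(symdK c c').
have gd : ba_generated (ground `|` separated_members ground family) (symd c c').
  apply: generated_incl; left; apply: groundP; first exact: S_symd.
  by move=> y; rewrite essential_symd // e; tauto.
by apply: (alg_setU algG); exact: (alg_setD algG).
Qed.

End Essential.

(** * Countable closure and the gap *)

Lemma countable_seqs (T : eqType) (D : set T) : countable D ->
  countable [set A : seq T | forall x, x \in A -> D x].
Proof.
move=> /countable_injP[h hinj]; apply/countable_injP.
exists (fun A => pickle (map h A)) => A B /set_mem /= DA /set_mem /= DB.
move=> /(pcan_inj pickleK); elim: A B DA DB => [|x A IH] [|y B] //= DA DB [e1 e2].
have Dx : D x by apply: DA; exact: mem_head.
have Dy : D y by apply: DB; exact: mem_head.
have -> : x = y by apply: hinj e1; exact: mem_set.
congr cons; apply: IH e2 => z zs.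
  by apply: DA; rewrite in_cons zs orbT.
by apply: DB; rewrite in_cons zs orbT.
Qed.

Section ClosingOff.
Context (T : eqType) (Phi : seq T -> set T).
Hypothesis countPhi : forall A, countable (Phi A).

(** A finite list from the union of the stages already comes from one stage, and the next stage
    contains its image. *)
Lemma closing_off (B : set T) : countable B -> exists Q, [/\ countable Q,
  B `<=` Q & forall A : seq T, (forall a, a \in A -> Q a) -> Phi A `<=` Q].
Proof.
move=> cB; pose st := fix st n := if n is m.+1 then
  st m `|` \bigcup_(A in [set A : seq T | forall x, x \in A -> st m x]) Phi A else B.
have cst n : countable (st n).
  elim: n => // n IH /=; rewrite -bigcup2E;
    apply: bigcup_countable => // -[|[|k]] _ //=.
  by apply: bigcup_countable => //; exact: countable_seqs.
have mono n m : n <= m -> st n `<=` st m.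
  move=> /subnK <-; elim: (m - n) => [//|k IH]; apply: subset_trans IH _.
  by move=> x; left.
exists (\bigcup_n st n); split.
- exact: bigcup_countable.
- by move=> x Bx; exists 0.
- move=> A QA x Px.
  have [|a aA|M HM] := @ex_bound _ A (fun a M => st M a).
  + by move=> a M M' /mono; apply.
  + by have [n _ sa] := QA a aA; exists n.
  by exists M.+1 => //; right; exists A.
Qed.

End ClosingOff.

Lemma lex2_lt (x y : lex2) n : (forall i, i < n -> x i = y i) ->
  x n = false -> y n = true -> (x < y)%O.
Proof.
move=> e xn yn; have fd : first_diff x y = Some n.
  by apply/first_diff_SomeP; split=> //; rewrite xn yn.
rewrite lt_neqAle leEbig_lexi_order fd xn yn andbT.
by apply/eqP => xy; rewrite xy yn in xn.
Qed.

Definition bad (L : set lex2) (B : set (set_type L)) : set lex2 :=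
  [set p | adherent B p /\ ~ twosided B p].

(** A cylinder contains at most one adherent point with nothing of [B] to its left in the cylinder:
    given two, points of [B] near the smaller lie to the left of the larger. The right side is
    symmetric, and there are countably many cylinders. *)
Lemma countable_bad (L : set lex2) (B : set (set_type L)) : countable (bad B).
Proof.
pose near M p g := B g /\ pre M (val g) = pre M p.
pose lo (k : {M : nat & {ffun 'I_M -> bool}}) := [set p : lex2 | [/\ adherent B p,
  pre (tag k) p = tagged k &
  ~ exists g, near (tag k) p g /\ (val g < p)%O]].
pose hi (k : {M : nat & {ffun 'I_M -> bool}}) := [set p : lex2 | [/\ adherent B p,
  pre (tag k) p = tagged k &
  ~ exists g, near (tag k) p g /\ (p < val g)%O]].
have lo1 k p p' : lo k p -> lo k p' -> ~ (p < p')%O.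
  move=> [ap ep _] [_ ep' np'] lt; have [K HK] := pre_sep (negbT (lt_eqF lt)).
  have [g Bg eg] := ap (maxn (tag k) K); apply: np'; exists g; split.
    by split=> //; rewrite ep' -ep; apply: preW eg; rewrite leq_maxl.
  apply: (pre_lt lt HK) => //; apply: preW eg; rewrite leq_maxr //.
have hi1 k p p' : hi k p -> hi k p' -> ~ (p < p')%O.
  move=> [_ ep np] [ap' ep' _] lt; have [K HK] := pre_sep (negbT (lt_eqF lt)).
  have [g Bg eg] := ap' (maxn (tag k) K); apply: np; exists g; split.
    by split=> //; rewrite ep -ep'; apply: preW eg; rewrite leq_maxl.
  apply: (pre_lt lt HK) => //; apply: preW eg; rewrite leq_maxr //.
have c1 (U : set lex2) : (forall p p', U p -> U p' -> ~ (p < p')%O) -> countable U.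
  move=> H; apply: finite_set_countable; have [[p Up]|nU] := pselect (exists p, U p).
    apply: (@sub_finite_set _ _ [set p]) => // p' Up' /=.
    have [lt|lt|//] := ltgtP p' p; first by case: (H p' p).
    by case: (H p p').
  by apply: (@sub_finite_set _ _ set0) => // p Up; case: nU; exists p.
apply: (@sub_countable _ _ _ (\bigcup_k (lo k `|` hi k))).
  apply: subset_card_le => p [ap nts]; apply: contrapT => H; apply: nts => M.
  split; apply: contrapT => nex; apply: H; exists (existT _ M (pre M p)) => //;
    [left|right];
  by split=> // -[g [[Bg eg] gp]]; apply: nex; exists g.
apply: bigcup_countable => [|k _].
  exact: (@countableP ({M : nat & {ffun 'I_M -> bool}} : countType)).
rewrite -bigcup2E; apply: bigcup_countable => // -[|[|l]] _ //=; apply: c1.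
  exact: lo1.
exact: hi1.
Qed.

(** * Closed coverings from a Hausdorff gap *)

Section GapCovering.
Context (d : Order.disp_t) (I : orderType d) (a b : I -> set nat).
Hypothesis gap : hausdorff_gap a b.
Local Notation L := (lex_gap_points a b).

Lemma almost_subset_trans (A B C : set nat) :
  almost_subset A B -> almost_subset B C -> almost_subset A C.
Proof.
rewrite /almost_subset => AB BC.
apply: (@sub_finite_set _ _ ((A `\` B) `|` (B `\` C))).
  by move=> n [An nC]; have [Bn|nB] := pselect (B n); [right|left].
by rewrite finite_setU.
Qed.

Lemma almost_subset_bound (A B : set nat) : almost_subset A B ->
  exists m, forall n, m <= n -> A n -> B n.
Proof.
move=> /finite_seqP[s sE]; have [|n ns|m Hm] := @ex_bound _ s (fun n m => n < m).
- by move=> n M M' MM' nM; exact: leq_trans MM'.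
- by exists n.+1.
exists m => n mn An; apply: contrapT => nB.
have : n \in s by have := (seteqP _ _).1 sE => -[/(_ n)/= H _]; apply: H.
by move=> /Hm; rewrite ltnNge mn.
Qed.

(** Each [q] fails to fill the gap at some index. The countably many indices for [D] are bounded in
    omega_1, and failure persists at larger indices. *)
Lemma gap_beyond (D : set lex2) : countable D -> exists i0, forall q, D q ->
  ~ (almost_subset (a i0) [set n | q n] /\ almost_subset [set n | q n] (b i0)).
Proof.
have [[_ unc init] _ lt_ab nogap] := gap => cD.
have /choice[h Hh] : forall q : lex2, exists i,
    ~ (almost_subset (a i) [set n | q n] /\ almost_subset [set n | q n] (b i)).
  by move=> q; apply/existsNP => H; apply: nogap; exists [set n | q n].
have [i0 Hi0] : exists i0, forall q, D q -> (h q < i0)%O.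
  apply: contrapT => H; apply: unc.
  apply: (@sub_countable _ _ _ (\bigcup_(q in D) ([set j | (j < h q)%O] `|` [set h
    q]))).
    apply: subset_card_le => i _; apply: contrapT => nU; apply: H; exists i => q Dq.
    rewrite ltNge le_eqVlt; apply/negP => /orP[/eqP e|lt]; apply: nU; exists q => //.
      by right.
    by left.
  apply: bigcup_countable => // q _; rewrite -bigcup2E.
  by apply: bigcup_countable => // -[|[|l]] _ //=.
exists i0 => q Dq [aq qb]; apply: (Hh q).
have [[ab _] _ [ba _]] := lt_ab _ _ (Hi0 q Dq).
by split; [exact: almost_subset_trans ab aq|exact: almost_subset_trans qb ba].
Qed.

(** The closed set [G m] consists of the points lying between [a i0] and [b i0] from position [m]
    on. Points of [L] of larger index fall into some [G m]; the countable rest, [Z], is added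
    finitely many at a time. *)
Lemma gap_cover (D : set lex2) : countable D -> exists F : nat -> set lex2,
  [/\ forall m p, (forall M, exists2 x, F m x & pre M x = pre M p) -> F m p,
      forall m m', m <= m' -> F m `<=` F m',
      forall m x, F m x -> ~ D x &
      forall x, L x -> ~ D x -> exists m, F m x].
Proof.
move=> cD; have [i0 Hi0] := gap_beyond cD.
have [[_ _ init] _ lt_ab _] := gap.
pose G m := [set x : lex2 | forall n, m <= n -> (a i0 n -> x n) /\ (x n -> b i0 n)].
pose Z := [set x : lex2 | (exists2 i, (i <= i0)%O
  & x = charfun (a i) \/ x = charfun (b i))
   /\ ~ D x].
have cZ : countable Z.
  apply: (@sub_countable _ _ _ (\bigcup_(i in [set i | (i < i0)%O] `|` [set i0])
      ([set charfun (a i)] `|` [set charfun (b i)] : set lex2))).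
    apply: subset_card_le => x [[i ii0 xE] _]; exists i.
      by move: ii0; rewrite le_eqVlt => /orP[/eqP|]; [right|left].
    by case: xE => xE; [left|right].
  apply: bigcup_countable => [|i _]; rewrite -bigcup2E;
  by apply: bigcup_countable => // -[|[|l]] _ //=.
have /countable_injP[h hinj] := cZ.
exists (fun m => G m `|` [set x | Z x /\ h x < m]); split.
- move=> m p H; apply: contrapT => /not_orP[/existsNP[n /not_implyP[mn nG]] nZ].
  have [|k km|M HM] := @ex_bound _ (iota 0 m)
      (fun k M => forall x, Z x -> h x = k -> pre M x <> pre M p).
  + by move=> k M M' MM' nx x Zx hx e; apply: (nx x Zx hx); exact: preW e.
  + have [[x [Zx hx]]|nx] := pselect (exists x, Z x /\ h x = k); last first.
      by exists 0 => x Zx hx; case: nx; exists x.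
    have [|M HM] := @pre_sep x p.
      apply/eqP => xp; apply: nZ; rewrite -xp; split=> //.
      by move: km; rewrite mem_iota hx.
    by exists M => y Zy hy; rewrite (hinj y x) ?inE // hx.
  (* The precision covers the bit [n] at which [p] violates [G m], and separates [p] from the
     finitely many added points. *)
  have [x [Gx|[Zx hx]] e] := H (maxn M n.+1).
    apply: nG; have <- : x n = p n.
      by move/preP: e; apply; rewrite leq_maxr.
    exact: Gx.
  apply: (HM (h x) _ x Zx erefl); first by rewrite mem_iota.
  by apply: preW e; rewrite leq_maxl.
- move=> m m' mm' x [Gx|[Zx hx]]; [left|right].
    by move=> n m'n; apply: Gx; exact: leq_trans m'n.
  by split=> //; exact: leq_trans mm'.
- move=> m x [Gx|[[_ nD] _]] //; move=> /Hi0; apply.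
  split; apply: (@sub_finite_set _ _ `I_m); try exact: finite_II.
    move=> n /= [an nx]; rewrite ltnNge; apply/negP => mn.
    by apply: nx; exact: (Gx n mn).1.
  move=> n /= [xn nb]; rewrite ltnNge; apply/negP => mn.
  by apply: nb; exact: (Gx n mn).2.
- have inG (A : set nat) : almost_subset (a i0) A -> almost_subset A (b i0) ->
      exists m, G m (charfun A).
    move=> /almost_subset_bound[m Hm] /almost_subset_bound[m' Hm'].
    exists (maxn m m') => n; rewrite geq_max => /andP[mn m'n]; split.
      by move=> /(Hm n mn) An; rewrite /charfun; exact/mem_set.
    by move=> /set_mem; exact: Hm'.
  move=> x Lx nD; have [i xE] : exists i, x = charfun (a i) \/ x = charfun (b i).
    by case: Lx => -[i _ <-]; exists i; [left|right].
  have [ii0|i0i] := leP i i0.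
    exists (h x).+1; right; split=> //; split=> //; by exists i.
  have [[aa _] [ab _] [bb _]] := lt_ab _ _ i0i.
  have [m Gm] : exists m, G m x.
    case: xE => ->; apply: inG => //; [exact: almost_subset_trans bb|].
    exact: almost_subset_trans ab.
  by exists m; left.
Qed.

End GapCovering.

Lemma open_cylinder (N : nat) (x : nat -> bool) :
  open [set y : cantor_space | forall i, i < N -> y i = x i].
Proof.
elim: N => [|N IH].
  rewrite (_ : mkset _ = setT); first exact: openT.
  by apply/seteqP; split.
rewrite (_ : mkset _ = [set y : cantor_space | forall i, i < N -> y i = x i] `&`
   proj N @^-1` [set x N]).
  apply: openI => //; apply: open_comp; last exact: discrete_open.
  by move=> y _; exact: (@proj_continuous nat (fun=> bool) N y).
apply/seteqP; split=> y /=.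
  by move=> H; split; [move=> i iN; apply: H; exact: leqW|exact: H].
by move=> [H e] i; rewrite ltnS leq_eqVlt => /orP[/eqP->//|]; exact: H.
Qed.

(** * Coding the patterns and choosing the countable set *)

Section SubalgebraOfCovered.
Context (L : set lex2).
Notation Om := (set_type L).
Notation pr N y := (pre N (val y)).
Notation word N := {ffun 'I_N -> bool}.
Hypothesis left_dense : forall (f : Om) N,
  exists2 y : Om, (y < f)%O & pr N y = pr N f.
Hypothesis cover : forall D : set lex2, countable D -> exists F : nat -> set lex2,
  [/\ forall m p, (forall M, exists2 x, F m x & pre M x = pre M p) -> F m p,
      forall m m', m <= m' -> F m `<=` F m',
      forall m x, F m x -> ~ D x &
      forall x, L x -> ~ D x -> exists m, F m x].
Context (S : set (set Om)) (x0 : Om).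
Hypothesis algS : ba_subalgebra S.
Hypothesis Sfin : S `<=` @fin_jumps L.
Implicit Types (u v c : set Om) (x y z a : Om) (A : seq Om).

(* The numbers tell, for each cylinder, whether the set is constant there (0),
   a ray with a free end point (1), or a ray whose end point is the [n]-th
   entry of a given list ([n.+2]); the booleans are as in [pe]. *)
Definition code := {N : nat & ({ffun word N -> nat} * {ffun word N -> bool})%type}.

Definition decode (g : code) A : pattern L :=
  let N := tag g in let k := (tagged g).1 in let e := (tagged g).2 in
  @Pattern L N (fun t => k t == 1) e [set y | let t := pr N y in
    if k t == 0 then e t else e t == (nth x0 A (k t - 2) <= y)%O].

(** The end points of one chosen element of [S] with the given pattern and with its end point for
    [t] in the cylinder [s], or nothing if there is none. With these in [Q], traces can be
    approximated from the ground. *)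
Definition picked (g : code) A (t : word (tag g)) M (s : word M) : set Om :=
  xget set0 [set B | exists u q, [/\ S u, fits (P := decode g A) u q,
    pr M (q t) = s & B = [set q t' | t' in [set: word (tag g)]]]].

Definition closure_points (g : code) A : set Om :=
  (\bigcup_(t in [set: word (tag g)]) \bigcup_(Ms in [set: {M : nat & word M}])
     picked A t (tagged Ms)) `|`
  (\bigcup_(t in [set: word (tag g)])
     [set x | bad (traces S (P := decode g A) t) (val x)]).

Lemma countable_closure_points g A : countable (closure_points g A).
Proof.
rewrite /closure_points -bigcup2E; apply: bigcup_countable => // -[|[|l]] _ //=.
  apply: bigcup_countable => [|t _]; first exact: countableP.
  apply: bigcup_countable => [|Ms _].
    exact: (@countableP ({M : nat & word M} : countType)).
  rewrite /picked; case: xgetP => // B _ [u [q [_ _ _ ->]]].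
  by apply: sub_countable (card_image_le _ _) _; exact: countableP.
apply: bigcup_countable => [|t _]; first exact: countableP.
have /countable_injP[h hinj] := countable_bad (traces S (P := decode g A) t).
apply/countable_injP; exists (h \o val) => x y /set_mem bx /set_mem by_ e.
by apply: val_inj; apply: hinj e; exact: mem_set.
Qed.

Lemma jump_ray (B : set Om) N x a e : jump B x ->
  (forall y, pr N y = pr N x -> (B y <-> e = (a <= y)%O)) -> x = a.
Proof.
move=> jx H; have [y yx ey] := left_dense x N.
have cyl z : (y <= z)%O -> (z < x)%O -> pr N z = pr N x.
  by move=> yz zx; rewrite -ey; exact: pr_conv yz (ltW zx) ey.
have [lt|lt|//] := ltgtP x a.
  have [z [yz zx nz]] := jx y yx; case: nz.
  by rewrite !H ?cyl // !leNgt lt (lt_trans zx lt).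
have [|z []] := jx (Order.max y a); first by rewrite gt_max yx.
rewrite ge_max => /andP[yz az] zx nz; case: nz.
by rewrite !H ?cyl // az (ltW lt).
Qed.

(** Each cylinder of length [N] contains at most one jump, and without a jump the set is constant
    there. *)
Lemma local_shape c N : fin_jumps c ->
  (forall x y, jump c x -> jump c y -> pr N x = pr N y -> x = y) ->
  forall t : word N,
    (exists e : bool, forall y, pr N y = t -> (c y <-> e)) \/
    (exists a (e : bool), [/\ pr N a = t, jump c a &
      forall y, pr N y = t -> (c y <-> e = (a <= y)%O)]).
Proof.
move=> fc sep t; have [[a [at_ ja]]|nj] := pselect (exists a, pr N a = t /\ jump c a).
  right; exists a, `[< c a >]; split=> // y yt.
  have only z : pr N z = t -> jump c z -> z = a by move=> zt jz; apply: sep;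
    rewrite ?zt.
  have [ay|ya] := leP a y.
    have -> : c y <-> c a.
      apply: iff_sym; apply: (jump_free fc ay) => z az zy jz.
      have zt : pr N z = t by rewrite -at_; apply: pr_conv (ltW az) zy _; rewrite at_.
      by rewrite (only z zt jz) ltxx in az.
    by split=> [ca|/asboolP//]; rewrite (asboolT ca).
  have [z [yz za nz]] := ja y ya.
  have -> : c y <-> c z.
    apply: (jump_free fc yz) => w yw wz jw.
    have wt : pr N w = t.
      by rewrite -yt; apply: pr_conv (ltW yw) (ltW (le_lt_trans wz za)) _; rewrite yt.
    by have := le_lt_trans wz za; rewrite (only w wt jw) ltxx.
  split=> [cz|/negbT/asboolPn nca]; first by apply/asboolPn => ca; apply: nz.
  by apply: contrapT => ncz; apply: nz.
left; exists `[< exists2 y, pr N y = t & c y >] => y yt.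
have cst z : pr N z = t -> (c z <-> c y).
  move=> zt; have [le|/ltW le] := leP z y; [|apply: iff_sym];
  apply: (jump_free fc le) => w wl wr jw; apply: nj; exists w; split=> //.
    by rewrite -zt; apply: pr_conv (ltW wl) wr _; rewrite zt.
  by rewrite -yt; apply: pr_conv (ltW wl) wr _; rewrite yt.
split=> [cy|/asboolP[z zt cz]]; last exact/(cst z zt).
by apply/asboolP; exists y.
Qed.

(** [Q] is closed under picked end points and one-sided limits. The families are indexed by a code,
    a finite list of fixed end points in [Q], and a level of the closed covering. *)
Lemma subalgebra_chain_generated :
  exists C, [/\ is_chain C, C `<=` S & S `<=` ba_generated C].
Proof.
pose Phi A := \bigcup_(g in [set: code]) closure_points g A.
have cPhi A : countable (Phi A).
  apply: bigcup_countable => [|g _]; last exact: countable_closure_points.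
  exact: (@countableP (code : countType)).
have [Q [cQ Qx0 QPhi]] := closing_off cPhi (countable1 x0).
(* [x0] is the default when a code reads beyond the end of its list, so it has to belong to [Q]. *)
have {}Qx0 : Q x0 by exact: Qx0.
have Qcl g A : (forall a, a \in A -> Q a) -> closure_points g A `<=` Q.
  by move=> QA; apply: subset_trans (QPhi A QA) => x gx; exists g.
pose seqQ := [set A : seq Om | forall a, a \in A -> Q a].
have cseqQ : countable seqQ by exact: countable_seqs.
(* The one-sided limits are removed in all of 2^omega; those that belong to [L] are already in
   [Q]. *)
pose D := (val @` Q) `|` \bigcup_(A in seqQ) \bigcup_(g in [set: code])
  \bigcup_(t in [set: word (tag g)]) bad (traces S (P := decode g A) t).
have cD : countable D.
  rewrite /D -bigcup2E; apply: bigcup_countable => // -[|[|l]] _ //=.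
    exact: sub_countable (card_image_le _ _) cQ.
  apply: bigcup_countable => // A _.
  apply: bigcup_countable => [|g _]; first exact: (@countableP (code : countType)).
  apply: bigcup_countable => [|t _]; [exact: countableP|exact: countable_bad].
have DQ x : D (val x) -> Q x.
  move=> [[y Qy /val_inj <-//]|[A QA [g _ [t _ bx]]]].
  by apply: (Qcl g A QA); right; exists t.
have [F [Fcl Fmono FD Fcov]] := cover cD.
pose idx : set (code * seq Om * nat) := (setT `*` seqQ) `*` setT.
have cidx : countable idx.
  apply: countableX => //; apply: countableX => //.
  exact: (@countableP (code : countType)).
have [|en enP ensurj] := @countable_enum _ idx
    (existT _ 0 ([ffun=> 0], [ffun=> false]), [::], 0) cidx.
  by split=> //; split.
pose A i := (en i).1.2; pose g i := (en i).1.1.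
have QA i : seqQ (A i) by case: (enP i) => -[].
apply: (@essential_chain L left_dense S Q x0 algS Sfin cQ
  (fun i => decode (g i) (A i)) (fun i => F (en i).2)).
- move=> i x /=; case: (g i) => N [k e] /= k1 jx.
  have Qnth n : Q (nth x0 (A i) n).
    have [lt|ge] := ltnP n (size (A i)); first by apply: QA; exact: mem_nth.
    by rewrite nth_default.
  have [k0|k0] := boolP (k (pr N x) == 0).
    have [y yx ey] := left_dense x N; have [z [yz zx nz]] := jx y yx.
    have ez : pr N z = pr N x by rewrite -ey; exact: pr_conv yz (ltW zx) ey.
    by case: nz; rewrite /= ez k0.
  rewrite (jump_ray (N := N) (a := nth x0 (A i) (k (pr N x) - 2)) (e := e (pr N x))
    jx) //.
  by move=> y ey; rewrite /= ey (negbTE k0); split=> /eqP.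
- move=> i t x M Wt [u [f [Su fu fx]]].
  have [u' [q [Su' fq eq BE]]] : exists u q, [/\ S u,
      fits (P := decode (g i) (A i)) u q, pr M (q t) = pr M x &
      picked (g := g i) (A i) t (pr M x) = [set q t' | t' in setT]].
    rewrite /picked; case: xgetP => [B _ [u' [q [? ? ? ->]]]|nB].
      by exists u', q.
    by case: (nB [set f t' | t' in setT]); exists u, f; rewrite -fx.
  exists u', q; split=> // t' _; apply: (Qcl (g i) (A i) (QA i)); left.
  exists t => //; exists (existT _ M (pr M x)) => //=; rewrite BE.
  by exists t'.
- by move=> i p; exact: Fcl.
- by move=> i x Fx Qx; apply: (FD _ _ Fx); left; exists x.
- move=> i t p Wt Fp ap; apply: contrapT => nts; apply: (FD _ _ Fp); right.
  by exists (A i) => //; exists (g i) => //; exists t.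
move=> c mc; have Sc : S c by case: mc.
have fc := Sfin Sc; have [J JE] := jumps_finite left_dense fc.
have [N sep] : exists N, forall x y, jump c x -> jump c y -> pr N x = pr N y -> x = y.
  have [|[x y] _|N HN] := @ex_bound _ [seq (x, y) | x <- J, y <- J]
      (fun xy N => pr N xy.1 = pr N xy.2 -> xy.1 = xy.2).
  - by move=> xy M M' MM' H /(preW MM'); exact: H.
  - have [->|ne] := eqVneq x y; first by exists 0.
    have [|M HM] := @pre_sep (val x) (val y); last by exists M => /HM.
    by apply: contra ne => /eqP/val_inj->.
  - exists N => x y /JE xJ /JE yJ; apply: (HN (x, y)).
    by apply/allpairsP; exists (x, y).
pose A0 := [seq a <- J | `[< Q a >]].
have QA0 : seqQ A0 by move=> a; rewrite mem_filter => /andP[/asboolP].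
have shape (t : word N) : exists s : nat * bool * Om,
    [\/ s.1.1 = 0 /\ forall y, pr N y = t -> (c y <-> s.1.2),
        [/\ s.1.1 = 1, essential Q c s.2, pr N s.2 = t &
          forall y, pr N y = t -> (c y <-> s.1.2 = (s.2 <= y)%O)] |
        exists n, [/\ s.1.1 = n.+2, Q s.2, nth x0 A0 n = s.2 &
          forall y, pr N y = t -> (c y <-> s.1.2 = (s.2 <= y)%O)]].
  have [[e He]|[a [e [at_ ja Ha]]]] := local_shape fc sep t.
    by exists (0, e, x0); constructor 1.
  have [Qa|nQa] := pselect (Q a); last by exists (1, e, a); constructor 2.
  exists ((index a A0).+2, e, a); constructor 3; exists (index a A0); split=> //.
  by rewrite nth_index // mem_filter (asboolT Qa) /=; exact/JE.
have [s sP] := choice shape.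
pose k : {ffun word N -> nat} := [ffun t => (s t).1.1].
pose e : {ffun word N -> bool} := [ffun t => (s t).1.2].
pose g0 : code := existT _ N (k, e).
(* The covering is increasing, so one level contains all the finitely many essential end points. *)
have [m Fm] : exists m, forall t : word N, essential Q c (s t).2 -> F m (val (s t).2).
  have [|t|m Hm] := @ex_bound_fin (word N)
      (fun t m => essential Q c (s t).2 -> F m (val (s t).2)).
  - by move=> t M M' MM' H /H; exact: Fmono.
  - have [ct|nct] := pselect (essential Q c (s t).2); last by exists 0.
    have [||m Hm] := Fcov (val (s t).2); last by exists m.
      exact: set_valP.
    by move=> /DQ; case: ct.
  by exists m.
have [|i ei] := ensurj (g0, A0, m); first by split=> //; split.
exists i; rewrite /member /g /A ei /=; exists (fun t => (s t).2).
have st (t : word N) : k t == 1 -> [/\ essential Q c (s t).2, pr N (s t).2 = t &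
    forall y, pr N y = t -> (c y <-> (s t).1.2 = ((s t).2 <= y)%O)].
  by rewrite ffunE; case: (sP t) => [[->]|[]|[n [->]]].
split=> //.
- split=> [y /=|y /= Wy|t /= /st[]//].
    rewrite !ffunE; case: (sP (pr N y)) => [[-> H] _|[->]//|[n [-> _ <- H]] _] /=.
      by rewrite H.
    by rewrite !subSS subn0 H //; split=> /eqP.
  by have [_ _ H] := st _ Wy; rewrite H // ffunE.
- move=> x; split=> [cx|[t /= /st[ct _ _] <-]//].
  have [jx nQx] := cx.
  have ex : x = (s (pr N x)).2 /\ k (pr N x) = 1; last first.
    by exists (pr N x); [rewrite /= ex.2|exact/esym/ex.1].
  rewrite ffunE; case: (sP (pr N x)) => [[_ H]|[k1 _ _ H]|[n [_ Qs _ H]]].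
  + have [y yx ey] := left_dense x N; have [z [yz zx nz]] := jx y yx.
    by case: nz; rewrite !H // -ey; exact: pr_conv yz (ltW zx) ey.
  + by rewrite k1; split=> //; exact: jump_ray jx H.
  + by case: nQx; rewrite (jump_ray jx H).
- by move=> t /= /st[ct _ _]; exact: Fm.
Qed.

End SubalgebraOfCovered.

Theorem theorem5p1 (d : Order.disp_t) (I : orderType d) (a b : I -> set nat)
  (gap_ab : hausdorff_gap a b)
  (dense_ab : @dense cantor_space (gap_points a b)) :
  hereditary (calB (set_type (lex_gap_points a b))).
Proof.
move=> S algS Scal; pose L := lex_gap_points a b.
have [[_ unc _] inf _ _] := gap_ab.
have left_dense (f : set_type L) N :
    exists2 y : set_type L, (y < f)%O & pre N (val y) = pre N (val f).
  (* The sets of the gap are infinite, so a bit 1 occurs beyond [N]; density gives a point of [L]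
     that agrees with [f] before this bit and has 0 there. *)
  have [n Nn fn] : exists2 n, N <= n & (val f : nat -> bool) n = true.
    have [A infA fE] : exists2 A, infinite_set A & val f = charfun A.
      have := set_valP f; rewrite /L /lex_gap_points /gap_points.
      by case=> -[i _ <-]; [exists (a i)|exists (b i)] => //; case: (inf i).
    apply: contrapT => H; apply: infA.
    apply: (@sub_finite_set _ _ `I_N); last exact: finite_II.
    move=> n An /=; rewrite ltnNge; apply/negP => Nn; apply: H; exists n => //.
    by rewrite fE; exact: mem_set.
  pose h : nat -> bool := fun i => if i < n then (val f : nat -> bool) i else false.
  have [|y [yh Ly]] := dense_ab _ _ (open_cylinder n.+1 h); first by exists h.
  have yE i : i < n -> y i = (val f : nat -> bool) i.
    by move=> i_n; rewrite (yh i (leqW i_n)) /h i_n.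
  exists (SigSub (mem_set (Ly : L y))).
    rewrite -lt_val; apply: (@lex2_lt _ _ n) => //=.
    by rewrite (yh n (leqnn _)) /h ltnn.
  by apply/preP => i iN /=; apply: yE; exact: leq_trans Nn.
have [i0 _] : exists i : I, True.
  by apply: contrapT => H; apply: unc; apply: (@sub_countable _ _ _ set0) => //;
    apply: subset_card_le => i _; apply: H; exists i.
have x0 : set_type L.
  by apply: (SigSub (mem_set (_ : L (charfun (a i0))))); left; exists i0.
have [C [chC CS SC]] := subalgebra_chain_generated left_dense (gap_cover gap_ab)
  x0 algS (subset_trans Scal (@calB_fin_jumps L)).
exact: chain_interval_algebra algS chC CS SC x0.
Qed.
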